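(* Let $a,b\in\mathbb{Q}$ be such that $f(x)=x^{12}+ax^6+b$ is irreducible over $\mathbb{Q}$, and let $r(x)=x^3-3bx+ab$. Then the Galois group $\mathrm{Gal}(f)$ (as a transitive subgroup of $S_{12}$ up to conjugacy) is determined as follows. \begin{enumerate} \item If $b(a^2-4b)\in\mathbb{Q}^2$: if $b\in\mathbb{Q}^3$ or $r(x)$ is reducible over $\mathbb{Q}$, then $\mathrm{Gal}(f)=12T11$; otherwise $\mathrm{Gal}(f)=12T39$. \item Else, if $b\in\mathbb{Q}^2$: \begin{enumerate} \item if $3(4b-a^2)\in\mathbb{Q}^2$: if $r(x)$ is reducible then $\mathrm{Gal}(f)=12T3$; else if $b\in\mathbb{Q}^3$ then $\mathrm{Gal}(f)=12T2$; otherwise $\mathrm{Gal}(f)=12T18$; \item else if $3(4b-a^2)\notin\mathbb{Q}^2$ and either $3(a+2\sqrt{b})\in\mathbb{Q}^2$ or $3(a-2\sqrt{b})\in\mathbb{Q}^2$: if $b\in\mathbb{Q}^3$ or $r(x)$ is reducible then $\mathrm{Gal}(f)=12T3$; otherwise $\mathrm{Gal}(f)=12T16$; \item else if $3(4b-a^2)\notin\mathbb{Q}^2$, $3(a+2\sqrt{b})\notin\mathbb{Q}^2$ and $3(a-2\sqrt{b})\notin\mathbb{Q}^2$: if $b\in\mathbb{Q}^3$ or $r(x)$ is reducible then $\mathrm{Gal}(f)=12T10$; otherwise $\mathrm{Gal}(f)=12T37$. \end{enumerate} \item Else (i.e. $b(a^2-4b)\notin\mathbb{Q}^2$ and $b\notin\mathbb{Q}^2$):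 \begin{enumerate} \item if $3(4b-a^2)\in\mathbb{Q}^2$: if $r(x)$ is reducible then $\mathrm{Gal}(f)=12T15$; else if $b\in\mathbb{Q}^3$ then $\mathrm{Gal}(f)=12T14$; otherwise $\mathrm{Gal}(f)=12T42$; \item else if $3(4b-a^2)\notin\mathbb{Q}^2$ and either $-3b\in\mathbb{Q}^2$ or $3b(4b-a^2)\in\mathbb{Q}^2$: if $b\in\mathbb{Q}^3$, then $\mathrm{Gal}(f)=12T12$ when $-3b\in\mathbb{Q}^2$ and $\mathrm{Gal}(f)=12T13$ otherwise; else if $b\notin\mathbb{Q}^3$ and $r(x)$ is reducible, then $\mathrm{Gal}(f)=12T12$ when $3b(4b-a^2)\in\mathbb{Q}^2$ and $\mathrm{Gal}(f)=12T13$ otherwise; otherwise $\mathrm{Gal}(f)=12T38$; \item else if $3(4b-a^2)\notin\mathbb{Q}^2$, $-3b\notin\mathbb{Q}^2$ and $3b(4b-a^2)\notin\mathbb{Q}^2$: if $b\in\mathbb{Q}^3$ or $r(x)$ is reducible then $\mathrm{Gal}(f)=12T28$; otherwise $\mathrm{Gal}(f)=12T81$. \end{enumerate} \end{enumerate}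
   Context: $\mathbb{Q}^2$ and $\mathbb{Q}^3$ denote the sets of squares and cubes of rational numbers. Galois groups of irreducible polynomials of degree $n$ are regarded as transitive subgroups of $S_n$ (via the action on the roots) up to conjugacy; $nTj$ denotes the $j$-th conjugacy class of transitive subgroups of $S_n$ in the standard numbering of Butler–McKay (as used in GAP's transitive groups library). $\sqrt{b}$ denotes a square root of $b$ (a rational number when $b\in\mathbb{Q}^2$). *)

(* Defs.v *)
From mathcomp Require Import all_boot all_order all_algebra all_fingroup all_field.
Set Implicit Arguments. Unset Strict Implicit. Unset Printing Implicit Defensive.
Import GRing.Theory Num.Theory.
Local Open Scope ring_scope.

Definition is_sq (q : rat) : Prop := exists c : rat, q = c ^+ 2.
Definition is_cube (q : rat) : Prop := exists c : rat, q = c ^+ 3.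

Definition f_ab (a b : rat) : {poly rat} := 'X^12 + a%:P * 'X^6 + b%:P.
Definition r_ab (a b : rat) : {poly rat} := 'X^3 - (3 * b)%:P * 'X + (a * b)%:P.

Definition root_enum (p : {poly rat}) (r : 'I_12 -> algC) : Prop :=
  injective r /\ map_poly ratr p = \prod_(i < 12) ('X - (r i)%:P).

(* s is the permutation of the roots induced by some field automorphism
   of the algebraic numbers (every automorphism of the splitting field
   extends to one of algC, and every ring endomorphism of algC restricts to
   one of the splitting field), i.e. s belongs to Gal(p) acting on the roots *)
Definition galois_perm (r : 'I_12 -> algC) (s : 'S_12) : Prop :=
  exists nu : {rmorphism algC -> algC}, forall i, nu (r i) = r (s i).

Definition gal_is (p : {poly rat}) (T : {set 'S_12}) : Prop :=
  forall r : 'I_12 -> algC, root_enum p r ->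
    exists t : 'S_12, forall s : 'S_12, galois_perm r s <-> (s ^ t)%g \in T.

Definition mkperm (l : seq nat) : 'S_12 :=
  insubd (1%g : 'S_12) [ffun i : 'I_12 => inord (nth 0%N l i) : 'I_12].
Definition pgroup_of (ls : seq (seq nat)) : {set 'S_12} :=
  <<[set:: map mkperm ls]>>%g.

(* 12T2: order 12; realised by a = -8, b = 64 *)
Definition T12_2 : {set 'S_12} := pgroup_of [:: [:: 1; 2; 3; 4; 5; 0; 11; 6; 7; 8; 9; 10]; [:: 6; 11; 10; 9; 8; 7; 0; 5; 4; 3; 2; 1]]%N.

(* 12T3: order 12; realised by a = 32, b = 64 *)
Definition T12_3 : {set 'S_12} := pgroup_of [:: [:: 1; 0; 5; 4; 3; 2; 9; 8; 7; 6; 11; 10]; [:: 6; 7; 8; 9; 10; 11; 0; 1; 2; 3; 4; 5]]%N.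

(* 12T10: order 24; realised by a = -5, b = 15625 *)
Definition T12_10 : {set 'S_12} := pgroup_of [:: [:: 0; 5; 4; 3; 2; 1; 6; 11; 10; 9; 8; 7]; [:: 1; 0; 5; 4; 3; 2; 11; 10; 9; 8; 7; 6]; [:: 6; 7; 8; 9; 10; 11; 0; 1; 2; 3; 4; 5]]%N.

(* 12T11: order 24; realised by a = -20, b = 2 *)
Definition T12_11 : {set 'S_12} := pgroup_of [:: [:: 0; 5; 4; 3; 2; 1; 6; 11; 10; 9; 8; 7]; [:: 7; 6; 11; 10; 9; 8; 4; 3; 2; 1; 0; 5]]%N.

(* 12T12: order 24; realised by a = -13, b = -27 *)
Definition T12_12 : {set 'S_12} := pgroup_of [:: [:: 0; 5; 4; 3; 2; 1; 11; 10; 9; 8; 7; 6]; [:: 6; 7; 8; 9; 10; 11; 0; 1; 2; 3; 4; 5]]%N.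

(* 12T13: order 24; realised by a = 0, b = -12 *)
Definition T12_13 : {set 'S_12} := pgroup_of [:: [:: 0; 5; 4; 3; 2; 1; 11; 10; 9; 8; 7; 6]; [:: 6; 7; 8; 9; 10; 11; 4; 5; 0; 1; 2; 3]]%N.

(* 12T14: order 24; realised by a = 35, b = 343 *)
Definition T12_14 : {set 'S_12} := pgroup_of [:: [:: 0; 1; 2; 3; 4; 5; 9; 10; 11; 6; 7; 8]; [:: 7; 6; 11; 10; 9; 8; 2; 1; 0; 5; 4; 3]]%N.

(* 12T15: order 24; realised by a = 0, b = 12 *)
Definition T12_15 : {set 'S_12} := pgroup_of [:: [:: 1; 2; 3; 4; 5; 0; 10; 11; 6; 7; 8; 9]; [:: 6; 11; 10; 9; 8; 7; 0; 5; 4; 3; 2; 1]]%N.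

(* 12T16: order 36; realised by a = 2, b = 25 *)
Definition T12_16 : {set 'S_12} := pgroup_of [:: [:: 1; 0; 5; 4; 3; 2; 7; 6; 11; 10; 9; 8]; [:: 6; 11; 10; 9; 8; 7; 4; 3; 2; 1; 0; 5]]%N.

(* 12T18: order 36; realised by a = -10, b = 100 *)
Definition T12_18 : {set 'S_12} := pgroup_of [:: [:: 1; 2; 3; 4; 5; 0; 7; 8; 9; 10; 11; 6]; [:: 6; 11; 10; 9; 8; 7; 2; 1; 0; 5; 4; 3]]%N.

(* 12T28: order 48; realised by a = -32, b = 1000 *)
Definition T12_28 : {set 'S_12} := pgroup_of [:: [:: 0; 1; 2; 3; 4; 5; 9; 10; 11; 6; 7; 8]; [:: 0; 5; 4; 3; 2; 1; 6; 11; 10; 9; 8; 7]; [:: 7; 6; 11; 10; 9; 8; 2; 1; 0; 5; 4; 3]]%N.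

(* 12T37: order 72; realised by a = -9, b = 144 *)
Definition T12_37 : {set 'S_12} := pgroup_of [:: [:: 0; 5; 4; 3; 2; 1; 6; 11; 10; 9; 8; 7]; [:: 1; 0; 5; 4; 3; 2; 7; 6; 11; 10; 9; 8]; [:: 6; 7; 8; 9; 10; 11; 2; 3; 4; 5; 0; 1]]%N.

(* 12T38: order 72; realised by a = -33, b = -192 *)
Definition T12_38 : {set 'S_12} := pgroup_of [:: [:: 0; 5; 4; 3; 2; 1; 7; 6; 11; 10; 9; 8]; [:: 6; 7; 8; 9; 10; 11; 4; 5; 0; 1; 2; 3]]%N.

(* 12T39: order 72; realised by a = 20, b = 10 *)
Definition T12_39 : {set 'S_12} := pgroup_of [:: [:: 0; 5; 4; 3; 2; 1; 6; 11; 10; 9; 8; 7]; [:: 6; 7; 8; 9; 10; 11; 1; 2; 3; 4; 5; 0]]%N.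

(* 12T42: order 72; realised by a = 21, b = 147 *)
Definition T12_42 : {set 'S_12} := pgroup_of [:: [:: 0; 1; 2; 3; 4; 5; 7; 8; 9; 10; 11; 6]; [:: 6; 11; 10; 9; 8; 7; 0; 5; 4; 3; 2; 1]]%N.

(* 12T81: order 144; realised by a = 22, b = 54 *)
Definition T12_81 : {set 'S_12} := pgroup_of [:: [:: 0; 1; 2; 3; 4; 5; 7; 8; 9; 10; 11; 6]; [:: 0; 5; 4; 3; 2; 1; 6; 11; 10; 9; 8; 7]; [:: 6; 7; 8; 9; 10; 11; 0; 1; 2; 3; 4; 5]]%N.

(* Main.v *)
(* Write the roots as x z^i and y z^j with z a primitive 6th root of unity, so
   that x^6 + y^6 = -a and x^6 y^6 = b. The Galois group G sits inside the group
   W of order 144 of all substitutions of the form z -> z^(+-1),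
   {x, y} -> {x z^i, y z^j}. Each arithmetic condition says that some explicit
   element is rational, i.e. fixed by G: the square roots of -3, b and a^2 - 4b
   and their products, s(x^3 +- y^3) with s^2 = -3 when b is a square, one of the
   cube roots w^k x^2 y^2 of b, or one of the roots
   w^k x^4 y^2 + w^(2k) x^2 y^4 of r, where w = z^2.

   The Sylow 3-subgroup of W is normal. The conditions on square roots determine
   the image of G in the quotient of order 16 (exponents mod 2); together with
   transitivity, those on cubes determine the intersection of G with the Sylow
   3-subgroup, already visible in the quotient of order 36 (exponents mod 3). In
   both quotients an element of G witnesses each failing condition, and a finite
   search shows that any such witnesses generate at least the claimed subgroup.
   These two data fix G, which is then conjugated onto the listed generators. *)

From HB Require Import structures.
Require Import Defs.
From mathcomp Require Import all_boot all_order all_algebra all_fingroup all_field.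
From mathcomp Require Import zify ring lra.
Set Implicit Arguments. Unset Strict Implicit. Unset Printing Implicit Defensive.
Import GRing.Theory Num.Theory.
Local Open Scope ring_scope.

(** * Automorphisms of the algebraic numbers *)

(** The roots of [minCpoly x] generate a number field that is normal over the rationals, so the
    embedding of Q(x) sending [x] to [y] extends first to an automorphism of that field and then to
    [algC]. *)
Lemma aut_root_minCpoly (x y : algC) :
  root (minCpoly x) y -> exists nu : {rmorphism algC -> algC}, nu x = y.
Proof.
move=> xy; have [p [Dp mon_p] min_p] := minCpolyP x.
have [r Dr] := closed_field_poly_normal (minCpoly x).
rewrite (monicP (minCpoly_monic x)) scale1r in Dr.
have rx : x \in r by rewrite -root_prod_XsubC -Dr root_minCpoly.
have ry : y \in r by rewrite -root_prod_XsubC -Dr.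
have [L [LC [s Ds genL]]] := num_field_exists r.
have [x1 Dx] : exists x1, LC x1 = x.
  by move: rx; rewrite -Ds => /mapP[x1 _ ->]; exists x1.
have [y1 Dy] : exists y1, LC y1 = y.
  by move: ry; rewrite -Ds => /mapP[y1 _ ->]; exists y1.
have LCp q : map_poly LC (map_poly (in_alg L) q) = map_poly ratr q.
  rewrite -map_poly_comp; apply: eq_map_poly => a.
  by rewrite /= rmorphZ_num rmorph1 mulr1.
have [m Dm] : exists m, minPoly 1 x1 = map_poly (in_alg L) m.
  have aP i : (minPoly 1 x1)`_i \in 1%VS.
    by apply/polyOverP; apply: minPolyOver.
  have{aP} a_ i := sig_eqW (vlineP _ _ (aP i)).
  exists (\poly_(i < size (minPoly 1 x1)) sval (a_ i)).
  apply/polyP=> i; rewrite coef_map coef_poly /=.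
  case: ifP => [_|/negbT]; first by case: (a_ i) => a /= ->.
  by rewrite -leqNgt scale0r => ?; rewrite nth_default.
have hom1 : kHom 1 1 (\1%VF : 'End(L)) by rewrite kHom1.
have min_y : root (minPoly 1 x1) y1.
  rewrite -(fmorph_root LC) Dm LCp Dy.
  have : p %| m by rewrite -min_p -LCp -Dm -Dx fmorph_root root_minPoly.
  by case/dvdpP => q ->; rewrite rmorphM rootM /= -Dp xy orbT.
have homE : kHom 1 <<1; x1>> (kHomExtend 1 \1 x1 y1).
  apply: kHomExtendP => //; rewrite (@eq_map_poly _ _ _ idfun) => [|a].
    by rewrite map_poly_id.
  by rewrite /= id_lfunE.
have Qpr : map_poly (in_alg L) p \is a polyOver 1%VS.
  by apply/polyOverP=> i; rewrite coef_map memvZ ?memv_line.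
have splitL : splittingFieldFor <<1; x1>> (map_poly (in_alg L) p) fullv.
  apply: splittingFieldForS (subv_adjoin _ _) (subvf _) _; exists s => //.
  congr (_ %= _): (eqpxx (map_poly (in_alg L) p)); apply/(map_poly_inj LC).
  rewrite LCp -Dp Dr -Ds big_map rmorph_prod /=; apply: eq_bigr => a _.
  by rewrite map_polyXsubC.
have [f hom_f Df] := kHom_extends (sub1v _) homE Qpr splitL.
pose fM := GRing.isMonoidMorphism.Build _ _ f (kHom_monoid_morphism hom_f).
pose phi : {rmorphism L -> L} := HB.pack (fun_of_lfun f) fM.
have [nu Dnu] := extend_algC_subfield_aut LC phi.
exists nu; rewrite -Dx -Dnu -Dy; congr (LC _) => /=.
rewrite -Df ?memv_adjoin // (kHomExtend_val hom1) //=.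
by rewrite (@eq_map_poly _ _ _ idfun) ?map_poly_id // => a; rewrite /= id_lfunE.
Qed.

(** If all roots of the minimal polynomial were equal to [x], their sum, up to sign a rational
    coefficient, would be a positive multiple of [x]. So an irrational [x] has a conjugate other
    than itself. *)
Lemma nCrat_aut_move (x : algC) : x \notin Crat ->
  exists nu : {rmorphism algC -> algC}, nu x != x.
Proof.
move=> nCx; have [r Dr] := closed_field_poly_normal (minCpoly x).
rewrite (monicP (minCpoly_monic x)) scale1r in Dr.
have [/hasP[y ry neq_yx]|/hasPn r_x] := boolP (has (predC1 x) r).
  rewrite -root_prod_XsubC -Dr in ry.
  by have [nu Dnu] := aut_root_minCpoly ry; exists nu; rewrite Dnu.
case/negP: nCx.
have sz_r : size r != 0%N.
  by move: (size_minCpoly x); rewrite Dr size_prod_XsubC; case: (size r).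
have : (minCpoly x)`_(size r).-1 \in Crat.
  by have [p [-> _] _] := minCpolyP x; rewrite coef_map Crat_rat.
rewrite Dr coefPn_prod_XsubC // rpredN.
have -> : \sum_(y <- r) y = x * (size r)%:R.
  rewrite (eq_big_seq (fun=> x)) => [|y /r_x/negPn/eqP //].
  by rewrite big_const_seq count_predT iter_addr_0 mulr_natr.
have sz_r0 : (size r)%:R != 0 :> algC by rewrite pnatr_eq0.
move=> Cx; rewrite -(mulfK sz_r0 x).
by apply: rpred_div => //; exact: rpred_nat.
Qed.

Lemma aut_root_irreducible (p : {poly rat}) (x y : algC) : irreducible_poly p ->
    root (map_poly ratr p) x -> root (map_poly ratr p) y ->
  exists nu : {rmorphism algC -> algC}, nu x = y.
Proof.
move=> [_ irr_p] px py; apply: aut_root_minCpoly.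
have [q [Dq _] min_q] := minCpolyP x.
have sz_q : size q != 1%N.
  rewrite -(size_map_poly (ratr : {rmorphism rat -> algC}) q) -Dq neq_ltn.
  by rewrite size_minCpoly orbT.
have eqp : q %= p by apply: irr_p sz_q _; rewrite -min_q.
by rewrite Dq (eqp_root (q := map_poly ratr p)) // eqp_map.
Qed.

Local Open Scope nat_scope.

(** * The group of order 144 and its quotients *)

(* [(e, c, i, j)] stands for the automorphism with z -> z^-1 if [c] (else z -> z),
   x -> x z^i, y -> y z^j if [~~ e], and x -> y z^i, y -> x z^j if [e]. The same
   type, with exponents mod 2 or 3, represents the two quotients. *)
Notation code := (bool * bool * nat * nat)%type.

Definition codes (m : nat) : seq code :=
  [seq (x.1, x.2, y.1, y.2) |
    x <- [seq (e, c) | e <- [:: false; true], c <- [:: false; true]],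
    y <- [seq (i, j) | i <- iota 0 m, j <- iota 0 m]].

(** Inverting z negates exponents; the factor m-1 expresses this within [nat]. Since 5 is 1 mod 2
    and 2 mod 3, twisting mod 6 is compatible with both reductions. *)
Definition twist (m : nat) (c : bool) (k : nat) := if c then m.-1 * k else k.

(* Product in the order of permutations: first [w1], then [w2]. *)
Definition cmul (m : nat) (w1 w2 : code) : code :=
  let '(e1, c1, i1, j1) := w1 in let '(e2, c2, i2, j2) := w2 in
  (e1 (+) e2, c1 (+) c2, (twist m c2 i1 + (if e1 then j2 else i2)) %% m,
   (twist m c2 j1 + (if e1 then i2 else j2)) %% m).

Definition cone : code := (false, false, 0, 0).

Definition cred (m : nat) (w : code) : code :=
  let '(e, c, i, j) := w in (e, c, i %% m, j %% m).

Lemma mem_codes m e c i j :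
  ((e, c, i, j) \in codes m) = (i < m) && (j < m).
Proof.
apply/allpairsP/andP => [[[[a b] [x y]] /= [_]]|[im jm]].
  by case/allpairsP=> -[x' y'] /= []; rewrite !mem_iota => ? ? [-> ->] [_ _ -> ->].
exists ((e, c), (i, j)); split=> //.
  by apply/allpairsP; exists (e, c); split=> //=; rewrite !inE; [case: e|case: c].
by apply/allpairsP; exists (i, j); rewrite !mem_iota.
Qed.

Lemma cmul_codes m w1 w2 : 0 < m -> cmul m w1 w2 \in codes m.
Proof.
case: w1 => [[[e1 c1] i1] j1]; case: w2 => [[[e2 c2] i2] j2] m0.
by rewrite mem_codes !ltn_mod m0.
Qed.

Lemma red_codes m w : 0 < m -> cred m w \in codes m.
Proof. by case: w => [[[e c] i] j] m0; rewrite mem_codes !ltn_mod m0. Qed.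

Lemma red2M w1 w2 : cred 2 (cmul 6 w1 w2) = cmul 2 (cred 2 w1) (cred 2 w2).
Proof.
case: w1 => [[[e1 c1] i1] j1]; case: w2 => [[[e2 c2] i2] j2] /=.
by rewrite /twist; congr (_, _, _, _); case: e1 c2 => [] [] /=; lia.
Qed.

Lemma red3M w1 w2 : cred 3 (cmul 6 w1 w2) = cmul 3 (cred 3 w1) (cred 3 w2).
Proof.
case: w1 => [[[e1 c1] i1] j1]; case: w2 => [[[e2 c2] i2] j2] /=.
by rewrite /twist; congr (_, _, _, _); case: e1 c2 => [] [] /=; lia.
Qed.

(** * Subgroups generated by prescribed witnesses *)

(* The fuel [n] bounds the number of elements processed; only the soundness of
   the enumeration matters, so no completeness is proved. *)
Fixpoint sweep (m n : nat) (gens todo seen : seq code) : seq code :=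
  if n isn't n'.+1 then seen else
  if todo isn't x :: todo' then seen else
  let new := [seq y <- undup [seq cmul m x g | g <- gens] | y \notin seen] in
  sweep m n' gens (new ++ todo') (new ++ seen).

(** The fuel 144, the order of W, suffices because each element is queued at most once. *)
Definition gclosure m gens := sweep m 144 gens [:: cone] [:: cone].

(** Filtering the old generators by membership lets the soundness invariant speak of the element
    list alone. Listing the closure in the order of [codes m] gives a normal form that [add_new] can
    compare. *)
Definition grow m (x : seq code * seq code) (w : code) :=
  let gens := w :: [seq y <- x.1 | y \in x.2] in
  let cl := gclosure m gens in (gens, [seq y <- codes m | y \in cl]).

Definition add_new (L : seq (seq code * seq code)) x :=
  if has (fun y => y.2 == x.2) L then L else x :: L.

Definition search_step m (U : pred code) L (Y : pred code) :=
  foldl (fun L' x =>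
    if has Y x.2 then add_new L' x else
    foldl (fun L'' w => if U w && Y w then add_new L'' (grow m x w) else L'')
      L' (codes m))
    [::] L.

(* A subgroup of [U] with an element in each of the sets [Ys] contains one of the
   subgroups in [search m U Ys] (the second components, the first being generators). *)
Definition search m U Ys := foldl (search_step m U) [:: ([::], [:: cone])] Ys.

Lemma foldl_inv (T S : Type) (f : S -> T -> S) (Q : S -> Prop) :
  (forall s x, Q s -> Q (f s x)) -> forall xs s, Q s -> Q (foldl f s xs).
Proof. by move=> Qf; elim=> //= x xs IHxs s /Qf/IHxs. Qed.

Lemma foldl_hit (T : eqType) (S : Type) (f : S -> T -> S) (Q : S -> Prop) x xs :
    (forall s y, Q s -> Q (f s y)) -> (forall s, Q (f s x)) -> x \in xs ->
  forall s, Q (foldl f s xs).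
Proof.
move=> Qf Qx; elim: xs => //= y xs IHxs; rewrite inE => /predU1P[<-|/IHxs//] s.
exact: foldl_inv.
Qed.

Section Closed.

Variables (m : nat) (P : code -> Prop).
Hypotheses (P1 : P cone) (PM : forall w1 w2, P w1 -> P w2 -> P (cmul m w1 w2)).

Lemma sweep_closed n gens todo seen : {in gens, forall g, P g} ->
    {in seen, forall w, P w} -> {subset todo <= seen} ->
  {in sweep m n gens todo seen, forall w, P w}.
Proof.
move=> Pg; elim: n todo seen => // n IHn [|x todo] // seen Ps sub /=.
apply: IHn => w; rewrite !mem_cat; last first.
  by case/orP=> [->//|tw]; rewrite sub ?orbT // inE tw orbT.
rewrite mem_filter mem_undup => /orP[/andP[_ /mapP[g gg ->]]|/Ps //].
by apply: PM; [apply: Ps; apply: sub; rewrite mem_head | apply: Pg].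
Qed.

Lemma closure_closed gens :
  {in gens, forall g, P g} -> {in gclosure m gens, forall w, P w}.
Proof.
by move=> Pg; apply: sweep_closed => // w; rewrite inE => /eqP->.
Qed.

Definition witnessed (U : pred code) (Ys : seq (pred code)) :=
  foldr (fun Y Q => (exists2 w, P w & [&& w \in codes m, U w & Y w]) /\ Q) True Ys.

(** The invariant [ok] says that some entry of the current list lies inside [P]. If that entry
    already meets the next set, it is kept; otherwise the branch adding the actual witness of [P]
    stays inside [P], by closure under products. *)
Lemma search_sound U Ys targets : witnessed U Ys ->
    all (fun x => all (mem x.2) targets) (search m U Ys) ->
  {in targets, forall w, P w}.
Proof.
pose good (x : seq code * seq code) := {in x.2, forall w, P w}.
pose ok (L : seq (seq code * seq code)) := exists2 x, x \in L & good x.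
have ok_add L x : ok L -> ok (add_new L x).
  by case=> z Lz gz; rewrite /add_new; case: ifP => _; exists z; rewrite // inE Lz orbT.
have ok_new L x : good x -> ok (add_new L x).
  rewrite /add_new; case: hasP => [[y Ly /eqP yx]|_] gx.
    by exists y; rewrite // /good yx.
  by exists x; rewrite // mem_head.
have ok_grow x w : good x -> P w -> good (grow m x w).
  move=> gx Pw y /=; rewrite mem_filter => /andP[+ _]; apply: closure_closed => z.
  by rewrite inE mem_filter => /predU1P[->//|/andP[/gx]].
suffices ok_search L : ok L -> witnessed U Ys -> ok (foldl (search_step m U) L Ys).
  move=> wY /allP sub w tw; have [|x Lx gx] := ok_search [:: ([::], [:: cone])] _ wY.
    by exists ([::], [:: cone]); rewrite ?mem_head // => y; rewrite inE => /eqP->.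
  by apply: gx; have /allP/(_ w tw) := sub x Lx.
elim: Ys L => // Y Ys IH L okL [[w Pw /and3P[mw Uw Yw]] wYs] /=; apply: IH => //.
case: okL => x0 Lx0 gx0.
have ok_if L1 x v : ok L1 -> ok (if U v && Y v then add_new L1 (grow m x v) else L1).
  by case: ifP => // _; apply: ok_add.
apply: (foldl_hit (Q := ok) _ _ Lx0) => [L1 x okL1|L1].
  case: ifP => _; first exact: ok_add.
  by apply: (foldl_inv (Q := ok)) okL1 => L2 v; apply: ok_if.
case: ifP => _; first exact: ok_new.
apply: (foldl_hit (Q := ok) _ _ mw) => [L2 v|L2]; first exact: ok_if.
by rewrite Uw Yw; apply: ok_new; apply: ok_grow.
Qed.

End Closed.

(** * The action on twelve indices and the finite checks *)

(** For k < 6, index k stands for the root x z^k and index 6 + k for y z^k. *)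
Definition wact (w : code) (k : nat) : nat :=
  let '(e, c, i, j) := w in
  if k < 6 then (if e then 6 else 0) + (twist 6 c k + i) %% 6
  else (if e then 0 else 6) + (twist 6 c (k - 6) + j) %% 6.

Lemma act_lt w k : wact w k < 12.
Proof.
case: w => [[[e c] i] j] /=.
have := ltn_mod (twist 6 c k + i) 6; have := ltn_mod (twist 6 c (k - 6) + j) 6.
by case: ifP => _; case: e => /=; lia.
Qed.

Lemma actM w1 w2 k : k < 12 -> wact (cmul 6 w1 w2) k = wact w2 (wact w1 k).
Proof.
case: w1 => [[[e1 c1] i1] j1]; case: w2 => [[[e2 c2] i2] j2] /= k12.
have mod6 x : x %% 6 < 6 by rewrite ltn_mod.
have mod6' x : (6 + x < 6) = false by lia.
case: ifP => k6; case: e1; rewrite ?add0n ?mod6 ?mod6' ?addKn; case: e2 => /=;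
  rewrite /twist; case: c1; case: c2; rewrite /= ?add0n; lia.
Qed.

Definition wlist (w : code) : seq nat := mkseq (wact w) 12.

(* The characters of the quotient of order 16: [p] selects among e, c, i, j. On
   the subgroup i = j (mod 2), where b is a square, i alone is a character too. *)
Definition parity (p : bool * bool * bool * bool) (w : code) : bool :=
  let '(pe, pc, pi, pj) := p in let '(e, c, i, j) := w in
  (pe && e) (+) (pc && c) (+) (pi && odd i) (+) (pj && odd j).

Lemma parity_red p w : parity p (cred 2 w) = parity p w.
Proof. by case: p w => [[[? ?] ?] ?] [[[e c] i] j] /=; rewrite !modn2 !oddb. Qed.

(* The images under [w] of the cube root of b, resp. the root of r, of index [k]. *)
Definition cube_idx (k : nat) (w : code) : nat :=
  let '(e, c, i, j) := w in (twist 3 c k + i + j) %% 3.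

Definition resolvent_idx (k : nat) (w : code) : nat :=
  let '(e, c, i, j) := w in twist 3 e (twist 3 c k + 2 * i + j) %% 3.

Lemma cube_idx_red k w : cube_idx k (cred 3 w) = cube_idx k w.
Proof. by case: w => [[[e c] i] j] /=; lia. Qed.

Lemma resolvent_idx_red k w : resolvent_idx k (cred 3 w) = resolvent_idx k w.
Proof. by case: w => [[[e c] i] j] /=; rewrite /twist; case: e; lia. Qed.

(** In this order, the characters of the square roots of b(a^2 - 4b), b, -3(a^2 - 4b), -3b, -3b(a^2
    - 4b) and -3. The last, [pP], belongs to s(x^3 +- y^3) with s^2 = -3. *)
Notation pS1 := (true, false, true, true).
Notation pB := (false, false, true, true).
Notation pQ := (true, true, false, false).
Notation pM := (false, true, true, true).
Notation pN := (true, true, true, true).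
Notation pZ := (false, true, false, false).
Notation pP b := (b, true, true, false).

Definition kernel (ps : seq (bool * bool * bool * bool)) (w : code) : bool :=
  all (fun p => ~~ parity p w) ps.

(** What transitivity provides: elements sending x to y z^i or x z^i with i in a given class mod 2,
    and mod 3 in [trans3]. The class of x itself is met by the identity. *)
Definition trans2 : seq (pred code) :=
  [:: (fun w : code => w.1.1.1 && ~~ odd w.1.2); (fun w => w.1.1.1 && odd w.1.2);
      (fun w => ~~ w.1.1.1 && odd w.1.2)].

Definition trans3 : seq (pred code) :=
  [:: (fun w : code => w.1.1.1 && (w.1.2 %% 3 == 0));
      (fun w : code => w.1.1.1 && (w.1.2 %% 3 == 1));
      (fun w : code => w.1.1.1 && (w.1.2 %% 3 == 2));
      (fun w : code => ~~ w.1.1.1 && (w.1.2 %% 3 == 1));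
      (fun w : code => ~~ w.1.1.1 && (w.1.2 %% 3 == 2))].

(* [Some (false, k)]: the k-th cube root of b is rational; [Some (true, k)]: the
   k-th root of r is; [None]: no constraint. *)
Definition fix3 (K : option (bool * nat)) (w : code) : bool :=
  match K with
  | Some (true, k) => resolvent_idx k w == k
  | Some (false, k) => cube_idx k w == k
  | None => true
  end.

Lemma fix3_red K w : fix3 K (cred 3 w) = fix3 K w.
Proof. by case: K => [[[] k]|] //=; rewrite ?cube_idx_red ?resolvent_idx_red. Qed.

Definition move3 (b : bool) : seq (pred code) :=
  [seq (fun w => ~~ fix3 (Some (b, k)) w) | k <- iota 0 3].

(** Generators of the expected intersection with the Sylow 3-subgroup: the translations with 2i + j
    = 0 (mod 3) fix the roots of r, those with i + j = 0 fix the cube roots of b. *)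
Definition targets3 (K : option (bool * nat)) : seq code :=
  match K with
  | Some (true, _) => [:: (false, false, 1, 1)]
  | Some (false, _) => [:: (false, false, 1, 2)]
  | None => [:: (false, false, 1, 1); (false, false, 1, 2)]
  end.

Definition check2 (pos neg : seq (bool * bool * bool * bool)) : bool :=
  all (fun x => all (mem x.2) [seq w <- codes 2 | kernel pos w])
    (search 2 (kernel pos) (trans2 ++ map parity neg)).

Definition check3 (K : option (bool * nat)) : bool :=
  all (fun x => all (mem x.2) (targets3 K))
    (search 3 (fix3 K)
      (trans3 ++ if K is Some _ then [::] else move3 false ++ move3 true)).

(* 4 is 0 mod 2 and 1 mod 3: the fourth power of any preimage of [w] in W. *)
Definition lift3 (w : code) : code :=
  let '(e, c, i, j) := w in (e, c, (4 * i) %% 6, (4 * j) %% 6).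

(** Two elements satisfying [fix3 K] with the same image mod 2 differ by an element of [N], so a
    group containing [N] can be recovered from its image mod 2. *)
Definition check_fill (K : option (bool * nat)) : bool :=
  let N := gclosure 6 (map lift3 (targets3 K)) in
  let E := [seq w <- codes 6 | fix3 K (cred 3 w)] in
  all (fun w => all (fun g =>
    (cred 2 g == cred 2 w) ==> has (fun n => cmul 6 g n == w) N) E) E.

Definition kinds : seq (option (bool * nat)) :=
  None :: [seq Some (b, k) | b <- [:: false; true], k <- iota 0 3].

Definition lcomp (l1 l2 : seq nat) : seq nat := [seq nth 0 l2 i | i <- l1].

(* Inverse of [wlist], meaningful only on lists of the form [wlist w]. *)
Definition decode (l : seq nat) : code :=
  (5 < nth 0 l 0, nth 0 l 1 != 6 * (5 < nth 0 l 0) + (nth 0 l 0).+1 %% 6,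
   nth 0 l 0 %% 6, nth 0 l 6 %% 6).

Definition relabel (c : bool) (i : nat) : seq nat :=
  iota 0 6 ++ [seq 6 + (twist 6 c k + i) %% 6 | k <- iota 0 6].

(* The first relabelling is only needed for 12T3 with e = c on G: there G is
   regular and its standard blocks are not the two sets of six roots. *)
Definition relabels : seq (seq nat) :=
  [:: 0; 7; 2; 11; 4; 9; 1; 6; 3; 10; 5; 8] ::
  [seq relabel c i | c <- [:: false; true], i <- iota 0 6].

Definition in_pos pos K (w : code) :=
  kernel pos (cred 2 w) && fix3 K (cred 3 w).

(** The code of t g t^-1, products being read from left to right; the inner [index] list is the
    inverse of [t]. *)
Definition pull (t g : seq nat) : code :=
  decode (lcomp t (lcomp g [seq index k t | k <- iota 0 12])).

(* Nested conditionals rather than [&&], which evaluates both sides under [vm_compute]. *)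
Definition check_conj pos K (gens : seq (seq nat)) (t : seq nat) : bool :=
  if perm_eq t (iota 0 12) && all (fun g => let w := pull t g in
      [&& perm_eq g (iota 0 12), w \in codes 6, in_pos pos K w &
          lcomp (wlist w) t == lcomp t g]) gens
  then let cl := gclosure 6 (map (pull t) gens) in
    all (fun w => if in_pos pos K w then w \in cl else true) (codes 6)
  else false.

(** * From lists and codes to permutations *)

Lemma mkpermE l (i : 'I_12) : perm_eq l (iota 0 12) -> mkperm l i = nth 0 l i :> nat.
Proof.
move=> l_perm; have sz_l : size l = 12 by rewrite (perm_size l_perm).
have l_lt k : k < 12 -> nth 0 l k < 12.
  move=> k12; have : nth 0 l k \in iota 0 12.
    by rewrite -(perm_mem l_perm) mem_nth ?sz_l.
  by rewrite mem_iota.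
rewrite -pvalE /mkperm [pval _]val_insubd ifT.
  by rewrite ffunE inordK // l_lt.
apply/injectiveP => x y; rewrite !ffunE => /(congr1 val).
rewrite /= !inordK ?l_lt // => /eqP.
rewrite nth_uniq ?sz_l ?(perm_uniq l_perm) ?iota_uniq // => /eqP; exact: val_inj.
Qed.

Lemma mkpermM l1 l2 l3 l4 :
    all (perm_eq^~ (iota 0 12)) [:: l1; l2; l3; l4] -> lcomp l1 l2 = lcomp l3 l4 ->
  (mkperm l1 * mkperm l2 = mkperm l3 * mkperm l4)%g.
Proof.
case/and5P=> p1 p2 p3 p4 _ E; apply/permP => i; apply: val_inj.
rewrite !permM /= !mkpermE //.
have /(congr1 (fun l => nth 0 l i)) := E.
by rewrite !(nth_map 0) ?(perm_size p1) ?(perm_size p3).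
Qed.

Lemma wlist_perm w : w \in codes 6 -> perm_eq (wlist w) (iota 0 12).
Proof.
suff /allP : all (fun w => perm_eq (wlist w) (iota 0 12)) (codes 6) by apply.
by vm_compute.
Qed.

Definition wperm (w : code) : 'S_12 := mkperm (wlist w).

Lemma wpermE w (i : 'I_12) : w \in codes 6 -> wperm w i = wact w i :> nat.
Proof. by move=> /wlist_perm wp; rewrite mkpermE // nth_mkseq. Qed.

Lemma wpermM w1 w2 : w1 \in codes 6 -> w2 \in codes 6 ->
  wperm (cmul 6 w1 w2) = (wperm w1 * wperm w2)%g.
Proof.
move=> m1 m2; apply/permP => i; apply: val_inj.
by rewrite permM /= !wpermE ?cmul_codes // actM.
Qed.

Lemma wperm1 : wperm cone = 1%g.
Proof.
apply/permP => i; apply: val_inj; rewrite perm1 /= wpermE //.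
by case: i => -[|[|[|[|[|[|[|[|[|[|[|[|]]]]]]]]]]]].
Qed.

(** Correctness of [decode] is not presupposed: [check_conj] verifies on lists that each pulled-back
    code is conjugate to its generator by [t]. One inclusion then follows from the enumerated
    closure, the other because the permutations coming from [E] form a group. *)
Lemma conj_sound (E : pred code) pos K gens t :
    {in codes 6, E =1 in_pos pos K} -> E cone ->
    (forall w1 w2, E w1 -> E w2 -> E (cmul 6 w1 w2)) ->
    check_conj pos K gens t ->
  forall s, (exists w, [/\ w \in codes 6, E w & s = wperm w]) <->
    (s ^ mkperm t)%g \in pgroup_of gens.
Proof.
rewrite /check_conj; case: ifP => // /andP[t_perm /allP gens_ok] Epos E1 EM Ecl s.
have gP g : g \in gens ->
    [/\ pull t g \in codes 6, E (pull t g)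
      & (wperm (pull t g) ^ mkperm t = mkperm g)%g].
  move=> /gens_ok/and4P[g_perm wE Ew /eqP Ct]; split; rewrite ?Epos //.
  apply/(mulgI (mkperm t)); rewrite -conjgC; apply: mkpermM => //=.
  by rewrite t_perm g_perm wlist_perm.
split=> [[w [mw Ew ->]]|].
  have /allP/(_ w mw) := Ecl; rewrite -Epos // Ew.
  pose P w := w \in codes 6 /\ (wperm w ^ mkperm t)%g \in pgroup_of gens.
  suff : {in gclosure 6 (map (pull t) gens), forall w, P w} by move=> /[apply] -[].
  apply: closure_closed => [|w1 w2 [m1 P1] [m2 P2]|_ /mapP[g gg ->]].
  - by split=> //; rewrite wperm1 conj1g /pgroup_of group1.
  - by split; rewrite ?cmul_codes // wpermM // conjMg /pgroup_of groupM.
  have [mg _ Dg] := gP g gg; split=> //; rewrite Dg mem_gen // inE.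
  exact: map_f.
have gG : group_set [set u | u \in [seq wperm w | w <- [seq w <- codes 6 | E w]]].
  apply/group_setP; split=> [|x y].
    by rewrite inE -wperm1 map_f // mem_filter E1.
  rewrite !inE => /mapP[w1 + ->] /mapP[w2 + ->]; rewrite !mem_filter.
  move=> /andP[E1w m1] /andP[E2w m2]; rewrite -wpermM // map_f //.
  by rewrite mem_filter EM ?cmul_codes.
rewrite /pgroup_of -[mkperm t]invgK -mem_conjg -genJ.
suff /subsetP sub : <<[set:: map mkperm gens] :^ (mkperm t)^-1>>%g \subset Group gG.
  move/sub; rewrite inE => /mapP[w]; rewrite mem_filter => /andP[Ew mw] Ds.
  by exists w.
rewrite gen_subG; apply/subsetP => x; rewrite mem_conjgV inE => /mapP[g gg Dx].
have [mw Ew Dg] := gP g gg.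
have -> : x = wperm (pull t g) by apply: (conjg_inj (mkperm t)); rewrite Dx Dg.
by rewrite inE map_f // mem_filter Ew.
Qed.
Lemma check3_kinds : all (fun K => check3 K && check_fill K) kinds.
Proof. by vm_compute. Qed.

Lemma check_fillP K w g : check_fill K ->
    w \in codes 6 -> fix3 K w -> g \in codes 6 -> fix3 K g -> cred 2 g = cred 2 w ->
  exists2 n, n \in gclosure 6 (map lift3 (targets3 K)) & cmul 6 g n = w.
Proof.
rewrite /check_fill; move: (gclosure _ _) (codes 6) => N W /allP chk mw Kw mg Kg Dg.
have /chk/allP/(_ g) : w \in [seq w <- W | fix3 K (cred 3 w)].
  by rewrite mem_filter fix3_red Kw.
rewrite mem_filter fix3_red Kg mg Dg eqxx => /(_ isT)/hasP[n Nn /eqP gn].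
by exists n.
Qed.

(** * Reconstructing the group from its images mod 2 and mod 3 *)

Section Witnessed.

Variables (m : nat) (P : code -> Prop) (U : pred code).

Lemma witnessed_cat Ys Zs :
  witnessed m P U Ys -> witnessed m P U Zs -> witnessed m P U (Ys ++ Zs).
Proof. by elim: Ys => //= Y Ys IH [wY wYs] wZs; split=> //; apply: IH. Qed.

Lemma witnessed_map (T : eqType) (f : T -> pred code) s :
    {in s, forall x, exists2 w, P w & [&& w \in codes m, U w & f x w]} ->
  witnessed m P U (map f s).
Proof.
elim: s => //= x s IH fs; split; first by apply: fs; rewrite mem_head.
by apply: IH => y ys; apply: fs; rewrite inE ys orbT.
Qed.

End Witnessed.

Section Determine.

Variable Gal : code -> Prop.
Hypotheses (Gal_codes : forall w, Gal w -> w \in codes 6) (Gal1 : Gal cone).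
Hypothesis GalM : forall w1 w2, Gal w1 -> Gal w2 -> Gal (cmul 6 w1 w2).
Hypothesis Gal_trans : forall k, k < 12 -> exists2 w, Gal w & wact w 0 = k.

Let image m v := exists2 w, Gal w & cred m w = v.

Let image_closed m : {morph cred m : w1 w2 / cmul 6 w1 w2 >-> cmul m w1 w2} ->
  forall v1 v2, image m v1 -> image m v2 -> image m (cmul m v1 v2).
Proof.
move=> redM v1 v2 [w1 G1 <-] [w2 G2 <-].
by exists (cmul 6 w1 w2); [apply: GalM | rewrite redM].
Qed.

Let act0 (e c : bool) i j : (e, c, i, j) \in codes 6 -> wact (e, c, i, j) 0 = 6 * e + i.
Proof.
rewrite mem_codes => /andP[i6 _]; rewrite /wact /twist /= muln0 if_same modn_small //.
by case: e.
Qed.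

(** The image of x determines only e and i, so [Y] must hold whatever c and j are. *)
Let witness_trans m (U : pred code) (e : bool) k : 0 < m -> k < 6 ->
    (forall w, Gal w -> U (cred m w)) -> forall Y : pred code,
    (forall c j, Y (e, c, k %% m, j %% m)) ->
  exists2 w, image m w & [&& w \in codes m, U w & Y w].
Proof.
move=> m0 k6 GU Y Yk; have [|[[[e' c] i] j] Gw] := Gal_trans (k := 6 * e + k).
  by case: e {Yk} => /=; lia.
have mw := Gal_codes Gw; rewrite act0 // => Ek.
have i6 : i < 6 by move: mw; rewrite mem_codes => /andP[].
have [De Di] : e' = e /\ i = k by case: e e' Ek {Yk Gw mw} => [] []; lia.
exists (cred m (e', c, i, j)); first by exists (e', c, i, j).
by rewrite red_codes // GU //= De Di Yk.
Qed.

Lemma fill2 pos neg : check2 pos neg ->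
    (forall w, Gal w -> kernel pos w) ->
    {in neg, forall p, exists2 w, Gal w & parity p w} ->
  forall v, v \in codes 2 -> kernel pos v -> image 2 v.
Proof.
move=> chk Gpos Gneg v mv kv.
have Gpos2 w : Gal w -> kernel pos (cred 2 w).
  by move=> /Gpos; apply: sub_all => p; rewrite parity_red.
have i1 : image 2 cone by exists cone.
have := search_sound i1 (image_closed red2M) _ chk.
apply=> //; last by rewrite mem_filter kv.
apply: witnessed_cat; last first.
  apply: witnessed_map => p /Gneg[w Gw pw]; exists (cred 2 w); first by exists w.
  by rewrite red_codes // Gpos2 // parity_red.
have W := witness_trans _ _ Gpos2.
split; first exact: (W true 0).
split; first exact: (W true 1).
by split; first exact: (W false 1).
Qed.

(** The search puts each target in the image of G mod 3. A preimage in G need not be a 3-element,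
    but its fourth power is exactly the lift of the target. *)
Lemma fill3 K : K \in kinds -> (forall w, Gal w -> fix3 K w) ->
    (K = None -> forall b k, k < 3 -> exists2 w, Gal w & ~~ fix3 (Some (b, k)) w) ->
  {in map lift3 (targets3 K), forall w, Gal w}.
Proof.
move=> /(allP check3_kinds)/andP[+ _] GK GN _ /mapP[v tv ->].
rewrite /check3 => chk.
have GK3 w : Gal w -> fix3 K (cred 3 w) by rewrite fix3_red; apply: GK.
have i1 : image 3 cone by exists cone.
have [w Gw Dv] : image 3 v.
  have := search_sound i1 (image_closed red3M) _ chk.
  apply=> //; apply: witnessed_cat.
    have W := witness_trans _ _ GK3.
    split; first exact: (W true 0).
    split; first exact: (W true 1).
    split; first exact: (W true 2).
    split; first exact: (W false 1).
    by split; first exact: (W false 2).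
  case: K GN GK3 {tv chk GK} => // /(_ erefl) GN GK3.
  have W b : witnessed 3 (image 3) (fix3 None) (move3 b).
    apply: witnessed_map => k; rewrite mem_iota => /andP[_ /(GN b)[w Gw nw]].
    by exists (cred 3 w); [exists w | rewrite red_codes // -fix3_red in nw *].
  exact: witnessed_cat.
have : exists i j, v = (false, false, i, j).
  case: K tv {GK GN chk GK3} => [[[] k]|]; rewrite /= ?inE; [| |case/orP] => /eqP->;
    by do 2!eexists.
case=> i [j Dv']; have Gw4 := GalM (GalM Gw Gw) (GalM Gw Gw).
congr Gal : Gw4; move: Dv; rewrite Dv'.
case: w {Gw} => [[[e c] x] y] /= [-> -> <- <-].
by rewrite /twist !addbb; congr (_, _, _, _); lia.
Qed.

(** G consists of all codes satisfying [in_pos pos K]: given such a [w], [fill2] yields [g] in G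
    with the same image mod 2, and [w] is [g] times an element of the group generated by the lifted
    targets, which [fill3] places in G. *)
Lemma Gal_conj pos neg K gens : check2 pos neg -> K \in kinds ->
    has (check_conj pos K gens) relabels ->
    (forall w, Gal w -> kernel pos w) ->
    {in neg, forall p, exists2 w, Gal w & parity p w} ->
    (forall w, Gal w -> fix3 K w) ->
    (K = None -> forall b k, k < 3 -> exists2 w, Gal w & ~~ fix3 (Some (b, k)) w) ->
  exists t, forall s, (exists2 w, Gal w & s = wperm w) <-> (s ^ t)%g \in pgroup_of gens.
Proof.
move=> chk2 kK /hasP[t _ chkt] Gpos Gneg GK GN.
have GE w : Gal w <-> w \in codes 6 /\ in_pos pos K w.
  split=> [Gw|[mw /andP[posw Kw]]].
    rewrite /in_pos fix3_red GK // andbT; split; first exact: Gal_codes.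
    by move: (Gpos _ Gw); apply: sub_all => p; rewrite parity_red.
  have [g Gg Dg] := fill2 chk2 Gpos Gneg (red_codes w (isT : 0 < 2)) posw.
  have /andP[_ chk] := allP check3_kinds K kK.
  rewrite fix3_red in Kw.
  have [n Nn <-] := check_fillP chk mw Kw (Gal_codes Gg) (GK _ Gg) Dg.
  apply: GalM => //.
  by apply: closure_closed Nn => //; apply: fill3.
have E1 : in_pos pos K cone by have [_] := (GE cone).1 Gal1.
pose E w := (w \in codes 6) && in_pos pos K w.
have GEb w : Gal w <-> E w by rewrite GE /E; split=> [[-> ->]|/andP[]].
exists (mkperm t) => s; rewrite -(conj_sound (E := E) _ _ _ chkt).
- split=> [[w Gw ->]|[w [_ /GEb Gw ->]]]; exists w => //.
  by split; [apply: Gal_codes | apply/GEb |].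
- by move=> w mw; rewrite /E mw.
- exact/GEb.
by move=> w1 w2 /GEb G1 /GEb G2; apply/GEb/GalM.
Qed.

End Determine.

Local Open Scope ring_scope.

(** * The Galois action on the roots *)

Section Roots.

Variables (a b : rat) (x y z : algC).
Hypotheses (sum_xy : x ^+ 6 + y ^+ 6 = - ratr a) (prod_xy : x ^+ 6 * y ^+ 6 = ratr b).
Hypotheses (neq_xy : x ^+ 6 != y ^+ 6) (x0 : x != 0) (y0 : y != 0).
Hypothesis prim_z : 6.-primitive_root z.

Let z6 : z ^+ 6 = 1. Proof. exact: prim_expr_order. Qed.

Let z3 : z ^+ 3 = -1.
Proof.
have : (z ^+ 3) ^+ 2 == 1 by rewrite -exprM z6.
by rewrite sqrf_eq1 -(prim_order_dvd prim_z) /= => /eqP.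
Qed.

Let z2 : z ^+ 2 = z - 1.
Proof.
have : (z + 1) * (z ^+ 2 - (z - 1)) = 0.
  by transitivity (z ^+ 3 + 1); [ring | rewrite z3 addNr].
move/eqP; rewrite mulf_eq0 => /orP[|]; last by rewrite subr_eq0 => /eqP.
rewrite addr_eq0 => /eqP z_N1.
have : z ^+ 2 == 1 by rewrite z_N1 sqrrN expr1n.
by rewrite -(prim_order_dvd prim_z).
Qed.

Let z5 : z ^+ 5 = 1 - z.
Proof. by rewrite (exprD z 3 2) z3 z2; ring. Qed.

Definition rho (k : nat) : algC :=
  if (k < 6)%N then x * z ^+ k else y * z ^+ (k - 6).

Definition acts (nu : {rmorphism algC -> algC}) (w : code) : Prop :=
  let '(e, c, i, j) := w in
  [/\ nu z = if c then z ^+ 5 else z, nu x = (if e then y else x) * z ^+ i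
    & nu y = (if e then x else y) * z ^+ j].

Lemma rho6 k : rho k ^+ 6 = if (k < 6)%N then x ^+ 6 else y ^+ 6.
Proof.
by rewrite /rho; case: ifP => _; rewrite exprMn -exprM mulnC exprM z6 expr1n mulr1.
Qed.

Lemma rho_inj k l : (k < 12)%N -> (l < 12)%N -> rho k = rho l -> k = l.
Proof.
move=> k12 l12 Ekl; have := rho6 k; rewrite Ekl rho6; move: Ekl; rewrite /rho.
have zP m n : (m < 6)%N -> (n < 6)%N -> z ^+ m = z ^+ n -> m = n.
  by move=> m6 n6 /eqP; rewrite (eq_prim_root_expr prim_z) !modn_small // => /eqP.
case: ifP => k6; case: ifP => l6 Ekl.
- by move=> _; apply: zP => //; apply: (mulfI x0).
- by move/esym/eqP; rewrite (negPf neq_xy).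
- by move/eqP; rewrite (negPf neq_xy).
move=> _; have : (k - 6 = l - 6)%N by apply: zP; [lia | lia | apply: (mulfI y0)].
by lia.
Qed.

Lemma root_rho k : root (map_poly ratr (f_ab a b)) (rho k).
Proof.
rewrite /root /f_ab !rmorphD rmorphM /= !map_polyXn !map_polyC /=.
rewrite hornerD hornerC hornerD hornerXn hornerM hornerC hornerXn (exprM _ 6 2) rho6.
rewrite -prod_xy.
have -> : ratr a = - (x ^+ 6 + y ^+ 6) :> algC by rewrite sum_xy opprK.
by apply/eqP; case: ifP => _; ring.
Qed.

Lemma nu_zk nu w k : acts nu w -> nu z ^+ k = z ^+ (twist 6 w.1.1.2 k).
Proof. by case: w => [[[e c] i] j] [-> _ _]; rewrite /twist /=; case: c; rewrite // -exprM. Qed.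

Lemma acts_rho nu w k : acts nu w -> (k < 12)%N -> nu (rho k) = rho (wact w k).
Proof.
move=> nuw k12; have nuz k' := nu_zk k' nuw; case: w nuw nuz => [[[e c] i] j] /= [_ nux nuy] nuz.
have zM l : z ^+ (l %% 6) = z ^+ l by apply: expr_mod.
rewrite /rho; case: ifP => k6; rewrite rmorphM rmorphXn nuz ?nux ?nuy -mulrA -exprD addnC;
  by case: (e); rewrite ?add0n ?ltn_mod ?ltnNge ?leq_addr /= ?addKn zM.
Qed.

Lemma actsM nu1 nu2 w1 w2 : acts nu1 w1 -> acts nu2 w2 ->
  acts (nu2 \o nu1) (cmul 6 w1 w2).
Proof.
move=> nuw1 nuw2; have nuz k := nu_zk k nuw2.
case: w1 w2 nuw1 nuw2 nuz => [[[e1 c1] i1] j1] [[[e2 c2] i2] j2] /=.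
move=> [nuz1 nux1 nuy1] [nuz2 nux2 nuy2] nuz.
have zM l : z ^+ (l %% 6) = z ^+ l by apply: expr_mod.
split; rewrite /= ?nuz1 ?nux1 ?nuy1 ?zM.
- case: (c1); last by rewrite nuz2.
  rewrite rmorphXn nuz /= /twist; case: (c2) => //=.
  (* Inverting twice raises z to the power 25, and 25 = 1 (mod 6). *)
  by rewrite -(expr_mod 25 z6).
- rewrite rmorphM rmorphXn nuz addnC exprD mulrA; congr (_ * _).
  by case: (e1); rewrite ?nux2 ?nuy2; case: (e2).
rewrite rmorphM rmorphXn nuz addnC exprD mulrA; congr (_ * _).
by case: (e1); rewrite ?nux2 ?nuy2; case: (e2).
Qed.

Lemma sixth_root (s t : algC) : t != 0 -> s ^+ 6 = t ^+ 6 ->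
  exists2 i, (i < 6)%N & s = t * z ^+ i.
Proof.
move=> t0 st; have : (s / t) ^+ 6 = 1 by rewrite expr_div_n st divff // expf_neq0.
by case/(prim_rootP prim_z) => i st1; exists i => //; rewrite -st1 mulrC divfK.
Qed.

(** The image of z is a root of t^2 - t + 1, hence z or 1 - z = z^5. The sum and product of x^6 and
    y^6 are rational, so these two are fixed or exchanged, which determines the images of x and y up
    to sixth roots of unity. *)
Lemma exists_acts nu : exists2 w, w \in codes 6 & acts nu w.
Proof.
have [c nuz] : exists c : bool, nu z = if c then z ^+ 5 else z.
  have : (nu z - z) * (nu z - (1 - z)) = 0.
    transitivity (nu z ^+ 2 - (nu z - 1) - (z ^+ 2 - (z - 1))); first by ring.
    by rewrite -rmorphXn z2 rmorphB rmorph1 !subrr.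
  move/eqP; rewrite mulf_eq0 !subr_eq0 => /orP[] /eqP->; first by exists false.
  by exists true; rewrite z5.
have nusum : nu x ^+ 6 + nu y ^+ 6 = x ^+ 6 + y ^+ 6.
  by rewrite -!rmorphXn -rmorphD sum_xy rmorphN fmorph_rat.
have nuprod : nu x ^+ 6 * nu y ^+ 6 = x ^+ 6 * y ^+ 6.
  by rewrite -!rmorphXn -rmorphM prod_xy fmorph_rat.
have : (nu x ^+ 6 - x ^+ 6) * (nu x ^+ 6 - y ^+ 6) = 0.
  transitivity (nu x ^+ 6 * (nu x ^+ 6 + nu y ^+ 6 - (x ^+ 6 + y ^+ 6)) -
    (nu x ^+ 6 * nu y ^+ 6 - x ^+ 6 * y ^+ 6)); first by ring.
  by rewrite nusum nuprod !subrr mulr0 subr0.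
move/eqP; rewrite mulf_eq0 !subr_eq0 => /orP[] /eqP nux6.
  have /(sixth_root y0)[j j6 nuy] : nu y ^+ 6 = y ^+ 6.
    by move: nusum; rewrite nux6 => /addrI.
  have [i i6 nux] := sixth_root x0 nux6.
  by exists (false, c, i, j); rewrite ?mem_codes ?i6.
have /(sixth_root x0)[j j6 nuy] : nu y ^+ 6 = x ^+ 6.
  by move: nusum; rewrite nux6 addrC => /addIr.
have [i i6 nux] := sixth_root y0 nux6.
by exists (true, c, i, j); rewrite ?mem_codes ?i6.
Qed.

Definition Gal (w : code) : Prop := w \in codes 6 /\ exists nu, acts nu w.

Lemma Gal_codes w : Gal w -> w \in codes 6. Proof. by case. Qed.

Lemma Gal1 : Gal cone.
Proof. by split=> //; exists idfun; split; rewrite ?mulr1. Qed.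

Lemma GalM w1 w2 : Gal w1 -> Gal w2 -> Gal (cmul 6 w1 w2).
Proof.
move=> [_ [nu1 nuw1]] [_ [nu2 nuw2]]; split; first exact: cmul_codes.
by exists (nu2 \o nu1); apply: actsM.
Qed.

Lemma Gal_trans k : irreducible_poly (f_ab a b) -> (k < 12)%N ->
  exists2 w, Gal w & wact w 0 = k.
Proof.
move=> irr k12.
have [nu nu0] := aut_root_irreducible irr (root_rho 0) (root_rho k).
have [w mw nuw] := exists_acts nu; exists w; first by split=> //; exists nu.
by apply: rho_inj => //; [apply: act_lt | rewrite -nu0 (acts_rho nuw)].
Qed.

(** Since [gal_is] quantifies over all enumerations of the roots, a given [r] is matched with [rho]
    by a permutation [p], and [p^-1 * t] does for [r] what [t] does for [rho]. *)
Lemma gal_is_of_Gal (T : {set 'S_12}) :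
    (exists t, forall s, (exists2 w, Gal w & s = wperm w) <-> (s ^ t)%g \in T) ->
  gal_is (f_ab a b) T.
Proof.
case=> t Tt r [r_inj Dr].
have r_root k : (k < 12)%N -> exists i, r i == rho k.
  move=> _; have := root_rho k; rewrite Dr rootE horner_prod => /prodf_eq0[i _].
  by rewrite hornerXsubC subr_eq0 eq_sym; exists i.
pose q (k : 'I_12) := xchoose (r_root k (ltn_ord k)).
have rq k : r (q k) = rho k by apply/eqP/(xchooseP (r_root k (ltn_ord k))).
have q_inj : injective q.
  move=> k l Ekl; apply: val_inj; apply: rho_inj; rewrite ?ltn_ord //.
  by rewrite -!rq Ekl.
pose p : 'S_12 := perm q_inj.
exists (p^-1 * t)%g => s; rewrite conjgM -Tt.
have conjE u : (s ^ p^-1 = u)%g <-> forall i, s (p i) = p (u i).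
  rewrite conjgE invgK mulgA; split=> [<- i|E]; first by rewrite !permM permKV.
  by apply/permP => i; rewrite !permM E permK.
have rp w (i : 'I_12) : w \in codes 6 -> r (p (wperm w i)) = rho (wact w i).
  by move=> mw; rewrite permE rq wpermE.
split=> [[nu nus]|[w [mw [nu nuw]] /conjE sw]].
  have [w mw nuw] := exists_acts nu; exists w; first by split=> //; exists nu.
  apply/conjE => i; apply: r_inj; rewrite rp // -nus permE rq.
  exact: acts_rho.
exists nu => i; rewrite -[i](permKV p) sw rp // -(acts_rho nuw) // permE rq.
by [].
Qed.

(** * Square roots and sign characters *)

Definition sign_act p (t : algC) : Prop := forall nu w, w \in codes 6 ->
  acts nu w -> nu t = (-1) ^+ parity p w * t.

Lemma sign_act_fixed p t : sign_act p t -> t != 0 -> t \in Crat ->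
  forall w, Gal w -> ~~ parity p w.
Proof.
move=> pt t0 Ct w [mw [nu nuw]]; have := pt nu w mw nuw.
rewrite (aut_Crat nu Ct); case: (parity p w) => //; rewrite expr1 mulN1r => /eqP.
by rewrite -addr_eq0 -mulr2n mulrn_eq0 (negPf t0).
Qed.

Lemma sign_act_moved p t : sign_act p t -> t \notin Crat ->
  exists2 w, Gal w & parity p w.
Proof.
move=> pt /nCrat_aut_move[nu]; have [w mw nuw] := exists_acts nu.
rewrite (pt nu w mw nuw); case: (boolP (parity p w)) => [pw _|_].
  by exists w => //; split=> //; exists nu.
by rewrite mul1r eqxx.
Qed.

Lemma sign_actM p1 p2 p t1 t2 :
    (forall w, parity p w = parity p1 w (+) parity p2 w) ->
  sign_act p1 t1 -> sign_act p2 t2 -> sign_act p (t1 * t2).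
Proof.
move=> pE pt1 pt2 nu w mw nuw; rewrite rmorphM (pt1 nu w) // (pt2 nu w) // pE.
by rewrite signr_addb mulrACA.
Qed.

Definition sqrtN3 : algC := 2 * z - 1.
Definition sqrtD : algC := x ^+ 6 - y ^+ 6.
Definition sqrtB : algC := x ^+ 3 * y ^+ 3.
(** With x^3 y^3 as the square root of b, a square root of 3(a - 2 sqrt b) when [s] is false and of
    3(a + 2 sqrt b) when it is true. *)
Definition sqrtP (s : bool) : algC := sqrtN3 * (x ^+ 3 + (-1) ^+ s * y ^+ 3).

Lemma sqrtN3_sqr : sqrtN3 ^+ 2 = ratr (- 3).
Proof.
rewrite rmorphN rmorph_nat; transitivity (4 * (z ^+ 2 - z) + 1 : algC).
  by rewrite /sqrtN3; ring.
by rewrite z2; ring.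
Qed.

Lemma sqrtD_sqr : sqrtD ^+ 2 = ratr (a ^+ 2 - 4 * b).
Proof.
rewrite rmorphB rmorphXn rmorphM rmorph_nat /= -prod_xy -sqrrN -sum_xy /sqrtD.
by ring.
Qed.

Lemma sqrtB_sqr : sqrtB ^+ 2 = ratr b.
Proof. by rewrite -prod_xy /sqrtB; ring. Qed.

Lemma sqrtP_sqr s : sqrtP s ^+ 2 = 3 * (ratr a - 2 * (-1) ^+ s * sqrtB).
Proof.
have -> : ratr a = - (x ^+ 6 + y ^+ 6) :> algC by rewrite sum_xy opprK.
rewrite /sqrtP exprMn sqrtN3_sqr rmorphN rmorph_nat /sqrtB.
by case: s; rewrite ?expr0 ?expr1; ring.
Qed.

Lemma sqrtN3_neq0 : sqrtN3 != 0.
Proof. by rewrite -sqrf_eq0 sqrtN3_sqr fmorph_eq0. Qed.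

Lemma sqrtD_neq0 : sqrtD != 0. Proof. by rewrite subr_eq0. Qed.

Lemma sqrtB_neq0 : sqrtB != 0. Proof. by rewrite mulf_neq0 ?expf_neq0. Qed.

Lemma sqrtP_neq0 s : sqrtP s != 0.
Proof.
rewrite mulf_neq0 ?sqrtN3_neq0 //; apply: contraNneq neq_xy => /eqP.
rewrite addr_eq0 => /eqP E; rewrite !(exprM _ 3 2) E sqrrN exprMn.
by rewrite sqrr_sign mul1r.
Qed.

Let nu_cube (t : algC) k : (t * z ^+ k) ^+ 3 = (-1) ^+ odd k * t ^+ 3.
Proof. by rewrite exprMn -exprM mulnC exprM z3 signr_odd mulrC. Qed.

Lemma sqrtN3_act : sign_act pZ sqrtN3.
Proof.
move=> nu [[[e c] i] j] _ [nuz _ _]; rewrite /sqrtN3 rmorphB rmorph1 rmorphM rmorph_nat nuz /=.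
by rewrite !addbF; case: c {nuz}; rewrite ?z5 ?expr1 ?expr0; ring.
Qed.

Lemma sqrtD_act : sign_act (true, false, false, false) sqrtD.
Proof.
move=> nu [[[e c] i] j] _ [_ nux nuy]; rewrite /sqrtD rmorphB !rmorphXn nux nuy /=.
have z6k k : (z ^+ k) ^+ 6 = 1 by rewrite -exprM mulnC exprM z6 expr1n.
rewrite !exprMn !z6k !mulr1 !addbF; case: (e); by rewrite ?expr1 ?expr0; ring.
Qed.

Lemma sqrtB_act : sign_act pB sqrtB.
Proof.
move=> nu [[[e c] i] j] _ [_ nux nuy]; rewrite /sqrtB rmorphM !rmorphXn nux nuy /= !nu_cube.
by rewrite signr_addb; case: (e); ring.
Qed.

(** Rationality of x^3 y^3 forces i = j (mod 2), so x^3 and y^3 pick up the same sign. *)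
Lemma sqrtP_act s : sqrtB \in Crat -> sign_act (pP s) (sqrtP s).
Proof.
move=> CB nu w mw nuw; have Gw : Gal w by split=> //; exists nu.
have := sign_act_fixed sqrtB_act sqrtB_neq0 CB Gw.
rewrite /sqrtP rmorphM (sqrtN3_act mw nuw) rmorphD [nu (_ * y ^+ 3)]rmorphM.
rewrite rmorph_sign !rmorphXn.
case: w mw nuw {Gw} => [[[e c] i] j] _ [_ -> ->] /=.
rewrite !nu_cube !addbF negb_add => /eqP <-.
by case: (s); case: (e); case: (c); case: (odd i); rewrite ?expr1 ?expr0; ring.
Qed.

Lemma is_sqP q t : t ^+ 2 = ratr q -> is_sq q <-> t \in Crat.
Proof.
move=> tq; split=> [[c qc]|/CratP[c tc]].
  have : t ^+ 2 == ratr c ^+ 2 by rewrite tq qc rmorphXn.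
  by rewrite eqf_sqr => /orP[]/eqP->; rewrite ?rpredN Crat_rat.
exists c; apply: (fmorph_inj (ratr : {rmorphism rat -> algC})).
by rewrite rmorphXn /= -tc -tq.
Qed.

(** * Cube roots of b and roots of the resolvent r *)

Definition om : algC := z ^+ 2.

Lemma prim_om : 3.-primitive_root om.
Proof. exact: (dvdn_prim_root prim_z (isT : 3 %| 6)%N). Qed.

Let om3 : om ^+ 3 = 1. Proof. exact: prim_expr_order prim_om. Qed.

Let omM k : om ^+ (k %% 3) = om ^+ k. Proof. exact: expr_mod om3. Qed.

Let om2 : om ^+ 2 = - om - 1.
Proof. by rewrite /om z2 sqrrB z2; ring. Qed.

Let nu_om nu w k : acts nu w -> nu (om ^+ k) = om ^+ (twist 3 w.1.1.2 k).
Proof.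
move=> nuw; rewrite rmorphXn rmorphXn (nu_zk _ nuw) /om /twist; case: ifP => _ //.
rewrite -!exprM -(expr_mod (2 * (3.-1 * k)) z6) -(expr_mod (6.-1 * 2 * k) z6).
by congr (_ ^+ _); lia.
Qed.

Let z2X l : (z ^+ l) ^+ 2 = om ^+ l. Proof. by rewrite -exprM mulnC exprM. Qed.

Definition cbrtB (k : nat) : algC := x ^+ 2 * y ^+ 2 * om ^+ k.

Lemma cbrtB_act nu w k : acts nu w -> nu (cbrtB k) = cbrtB (cube_idx k w).
Proof.
move=> nuw; rewrite /cbrtB 2!rmorphM (nu_om _ nuw) !rmorphXn.
case: w nuw => [[[e c] i] j] [_ -> ->] /=; rewrite omM !exprD.
rewrite [(_ * z ^+ i) ^+ 2]exprMn [(_ * z ^+ j) ^+ 2]exprMn !z2X.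
by case: (e) => /=; ring.
Qed.

Lemma cbrtB_inj k l : (k < 3)%N -> (l < 3)%N -> cbrtB k = cbrtB l -> k = l.
Proof.
move=> k3 l3 /mulfI; rewrite mulf_eq0 !expf_eq0 (negPf x0) (negPf y0) => /(_ isT)/eqP.
by rewrite (eq_prim_root_expr prim_om) !modn_small // => /eqP.
Qed.

Lemma is_cubeP : is_cube b <-> exists2 k, (k < 3)%N & cbrtB k \in Crat.
Proof.
have cube k : cbrtB k ^+ 3 = ratr b.
  by rewrite /cbrtB exprMn -exprM mulnC exprM om3 expr1n mulr1 -prod_xy; ring.
split=> [[c bc]|[k _ /CratP[c kc]]]; last first.
  exists c; apply: (fmorph_inj (ratr : {rmorphism rat -> algC})).
  by rewrite rmorphXn /= -kc cube.
have B0 : cbrtB 0 != 0 by rewrite /cbrtB mulr1 mulf_neq0 ?expf_neq0.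
have : (ratr c / cbrtB 0) ^+ 3 = 1.
  rewrite expr_div_n cube -rmorphXn -bc divff //.
  by rewrite /= -(cube 0%N) expf_neq0.
case/(prim_rootP prim_om) => k kc; exists k => //.
have -> : cbrtB k = ratr c; last exact: Crat_rat.
by rewrite -(divfK B0 (ratr c)) kc /cbrtB mulr1 mulrC.
Qed.

(** Cardano's formula: u = x^4 y^2 and v = x^2 y^4 satisfy uv = b and u^3 + v^3 = -ab, so r(t) = t^3
    - 3uvt - (u^3 + v^3). *)
Definition theta (k : nat) : algC :=
  om ^+ k * (x ^+ 4 * y ^+ 2) + om ^+ (2 * k) * (x ^+ 2 * y ^+ 4).

(** Swapping x and y exchanges the two summands, which amounts to negating the exponent of [om];
    hence the outer [twist 3 e] in [resolvent_idx]. *)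
Lemma theta_act nu w k : acts nu w -> nu (theta k) = theta (resolvent_idx k w).
Proof.
move=> nuw.
have dbl c : twist 3 c (2 * k) = (2 * twist 3 c k)%N by case: c => //=; lia.
have cub n : (om ^+ n) ^+ 3 = 1 by rewrite -exprM mulnC exprM om3 expr1n.
have z4X l : (z ^+ l) ^+ 4 = (om ^+ l) ^+ 2 by rewrite -z2X -[RHS]exprM.
have om2X n : om ^+ (2 * (n %% 3)) = (om ^+ n) ^+ 2 by rewrite mulnC exprM omM.
rewrite /theta rmorphD rmorphM [nu (_ * (x ^+ 2 * _))]rmorphM !(nu_om _ nuw) dbl.
rewrite [nu (x ^+ 4 * _)]rmorphM [nu (x ^+ 2 * _)]rmorphM !rmorphXn.
case: w nuw => [[[e c] i] j] [_ -> ->] /=; rewrite om2X omM.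
do 2!rewrite [(_ * z ^+ i) ^+ _]exprMn [(_ * z ^+ j) ^+ _]exprMn.
rewrite !z2X !z4X.
have dblX n : om ^+ (2 * n) = (om ^+ n) ^+ 2 by rewrite mulnC exprM.
move: (twist 3 c k) => t.
have -> : om ^+ twist 3 e (t + 2 * i + j) =
    if e then (om ^+ t * (om ^+ i) ^+ 2 * om ^+ j) ^+ 2
    else om ^+ t * (om ^+ i) ^+ 2 * om ^+ j.
  by rewrite -dblX -!exprD -dblX /twist; case: (e).
rewrite dblX.
move: (om ^+ t) (om ^+ i) (om ^+ j) (cub t) (cub i) (cub j) => T I J T3 I3 J3.
by case: (e); ring: T3 I3 J3.
Qed.

(** For distinct cube roots of unity K and L, the difference of the two values is (K - L) x^2 y^2
    (x^2 + (K + L) y^2). If it vanished, (K + L)^3 = -1 would give x^6 = y^6. *)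
Lemma theta_inj k l : (k < 3)%N -> (l < 3)%N -> theta k = theta l -> k = l.
Proof.
move=> k3 l3 E; have : om ^+ k = om ^+ l.
  apply/eqP; rewrite -subr_eq0; apply: contra_neqT neq_xy; rewrite subr_eq0 => neq_kl.
  have K3 : om ^+ k ^+ 3 = 1 by rewrite -exprM mulnC exprM om3 expr1n.
  have L3 : om ^+ l ^+ 3 = 1 by rewrite -exprM mulnC exprM om3 expr1n.
  move: E; rewrite /theta ![(2 * _)%N]mulnC !exprM.
  move: (om ^+ k) (om ^+ l) neq_kl K3 L3 => K L neq_kl K3 L3 E.
  have KL : K ^+ 2 + K * L + L ^+ 2 = 0.
    apply: (mulfI (_ : K - L != 0)); first by rewrite subr_eq0.
    by rewrite mulr0; transitivity (K ^+ 3 - L ^+ 3); [ring | rewrite K3 L3 subrr].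
  have E2 : x ^+ 2 = - ((K + L) * y ^+ 2).
    apply: (mulfI (_ : (K - L) * (x ^+ 2 * y ^+ 2) != 0)).
      by rewrite !mulf_neq0 ?expf_neq0 ?subr_eq0.
    apply/eqP; rewrite -subr_eq0; apply/eqP; transitivity
      (K * (x ^+ 4 * y ^+ 2) + K ^+ 2 * (x ^+ 2 * y ^+ 4) -
       (L * (x ^+ 4 * y ^+ 2) + L ^+ 2 * (x ^+ 2 * y ^+ 4))); first by ring.
    by rewrite E subrr.
  have KL3 : (K + L) ^+ 3 = -1.
    transitivity (3 * K * (K ^+ 2 + K * L + L ^+ 2) + L ^+ 3 - 2 * K ^+ 3); first by ring.
    by rewrite KL K3 L3; ring.
  rewrite (exprM x 2 3) (exprM y 2 3) E2 exprNn exprMn KL3.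
  by rewrite -signr_odd expr1; ring.
by move/eqP; rewrite (eq_prim_root_expr prim_om) !modn_small // => /eqP.
Qed.

Lemma horner_r_ab t : (map_poly ratr (r_ab a b)).[t] =
  (t - theta 0) * (t - theta 1) * (t - theta 2).
Proof.
rewrite /r_ab rmorphD rmorphB /= [map_poly _ ((3 * b)%:P * _)]rmorphM /=.
rewrite map_polyXn !map_polyC map_polyX /=.
rewrite hornerD hornerC hornerD hornerN hornerXn [((_)%:P * 'X).[_]]hornerM hornerC hornerX.
rewrite !rmorphM rmorph_nat /= -prod_xy.
have -> : ratr a = - (x ^+ 6 + y ^+ 6) :> algC by rewrite sum_xy opprK.
rewrite /theta; move: om2; move: om => W W2; ring: W2.
Qed.

Lemma reducible_rP : ~ irreducible_poly (r_ab a b) <->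
  exists2 k, (k < 3)%N & theta k \in Crat.
Proof.
have sz_r : size (r_ab a b) = 4%N.
  rewrite /r_ab -addrA size_polyDl ?size_polyXn // (leq_ltn_trans (size_polyD _ _)) //.
  rewrite gtn_max size_polyN ltnS (leq_trans (size_polyMleq _ _)) ?size_polyX ?size_polyC.
    by case: (_ != 0).
  by case: (_ != 0).
split=> [red|[k k3 /CratP[c kc]] [_ irr]]; last first.
  have : 'X - c%:P %| r_ab a b.
    rewrite -root_factor_theorem -(fmorph_root (ratr : {rmorphism rat -> algC})) /= -kc.
    rewrite rootE horner_r_ab; case: k k3 {kc} => [|[|[|//]]] _;
      by rewrite subrr ?(mulr0, mul0r).
  move/irr; rewrite size_XsubC => /(_ isT)/eqp_size.
  by rewrite size_XsubC sz_r.
have [/hasP[k]|/hasPn no_root] := boolP (has (fun k => theta k \in Crat) (iota 0 3)).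
  by rewrite mem_iota; exists k.
case: red; apply: cubic_irreducible; first by rewrite sz_r.
move=> c; rewrite -(fmorph_root (ratr : {rmorphism rat -> algC})) rootE horner_r_ab.
apply/negP; rewrite !mulf_eq0 !subr_eq0 -orbA => /or3P[] /eqP kc.
- by have := no_root 0%N isT; rewrite -kc Crat_rat.
- by have := no_root 1%N isT; rewrite -kc Crat_rat.
by have := no_root 2%N isT; rewrite -kc Crat_rat.
Qed.

Definition cubic_root (s : bool) : nat -> algC := if s then theta else cbrtB.

Lemma cubic_root_act nu w s k : acts nu w -> (k < 3)%N ->
  (nu (cubic_root s k) == cubic_root s k) = fix3 (Some (s, k)) w.
Proof.
have m3 n : (n %% 3 < 3)%N by rewrite ltn_mod.
move=> nuw k3; case: s => /=.
  rewrite (theta_act _ nuw); apply/eqP/eqP => [/theta_inj-> //|-> //].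
  by case: (w) => [[[e c] i] j] /=.
rewrite (cbrtB_act _ nuw); apply/eqP/eqP => [/cbrtB_inj-> //|-> //].
by case: (w) => [[[e c] i] j] /=.
Qed.

Lemma cubic_root_fixed s k : (k < 3)%N -> cubic_root s k \in Crat ->
  forall w, Gal w -> fix3 (Some (s, k)) w.
Proof. by move=> k3 Ck w [mw [nu nuw]]; rewrite -(cubic_root_act _ nuw) ?aut_Crat. Qed.

Lemma cubic_root_moved s k : (k < 3)%N -> cubic_root s k \notin Crat ->
  exists2 w, Gal w & ~~ fix3 (Some (s, k)) w.
Proof.
move=> k3 /nCrat_aut_move[nu]; have [w mw nuw] := exists_acts nu.
by rewrite (cubic_root_act _ nuw) //; exists w => //; split=> //; exists nu.
Qed.

(** * Matching arithmetic conditions with characters *)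

(** Among the keys in use, only [pP] involves i without j; in all others the last two bits agree, so
    [pj] alone records the factor [sqrtB]. *)
Definition quad (p : bool * bool * bool * bool) : algC :=
  let '(pe, pc, pi, pj) := p in
  if pi && ~~ pj then sqrtP pe else
  (if pc then sqrtN3 else 1) * (if pe then sqrtD else 1) * (if pj then sqrtB else 1).

Definition quad_keys (B : bool) :=
  [:: pS1; pB; pQ; pM; pN; pZ] ++ if B then [:: pP false; pP true] else [::].

Lemma quad_act B p : p \in quad_keys B -> (B -> sqrtB \in Crat) -> sign_act p (quad p).
Proof.
have one : sign_act (false, false, false, false) 1.
  by move=> nu [[[e c] i] j] _ _; rewrite rmorph1 expr0 mulr1.
have quad_mul pc pe pj : sign_act (pe, pc, pj, pj)
    ((if pc then sqrtN3 else 1) * (if pe then sqrtD else 1) * (if pj then sqrtB else 1)).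
  apply: (sign_actM (p1 := (pe, pc, false, false)) (p2 := (false, false, pj, pj))).
  - by move=> [[[e c] i] j] /=; case: pe e pc c pj (odd i) (odd j) => [] [] [] [] [] [] [].
  - apply: (sign_actM (p1 := (false, pc, false, false)) (p2 := (pe, false, false, false))).
    + by move=> [[[e c] i] j] /=; case: pe e pc c => [] [] [] [].
    + by case: pc; [apply: sqrtN3_act | apply: one].
    by case: pe; [apply: sqrtD_act | apply: one].
  by case: pj; [apply: sqrtB_act | apply: one].
rewrite mem_cat => /orP[]; last first.
  by case: B => //; rewrite !inE => /orP[] /eqP-> /(_ isT) CB; apply: sqrtP_act.
by rewrite !inE => /orP[|/orP[|/orP[|/orP[|/orP[]]]]] /eqP-> _; apply: quad_mul.
Qed.

Lemma quad_sqr pe pc pj : quad (pe, pc, pj, pj) ^+ 2 =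
  ratr ((if pc then - 3 else 1) * (if pe then a ^+ 2 - 4 * b else 1) * (if pj then b else 1)).
Proof.
rewrite /quad andbN !exprMn 2!rmorphM.
congr (_ * _ * _).
- by case: pc; rewrite ?sqrtN3_sqr // expr1n rmorph1.
- by case: pe; rewrite ?sqrtD_sqr // expr1n rmorph1.
by case: pj; rewrite ?sqrtB_sqr // expr1n rmorph1.
Qed.

Lemma quad_sqP pe pc pj q :
    q = (if pc then - 3 else 1) * (if pe then a ^+ 2 - 4 * b else 1) * (if pj then b else 1) ->
  is_sq q <-> quad (pe, pc, pj, pj) \in Crat.
Proof. by move=> ->; apply: is_sqP; apply: quad_sqr. Qed.

(** As -3 is negative it is no rational square; thus G always moves z, and [pZ] is a failing
    condition in every case. *)
Lemma quad_pZ_nCrat : quad pZ \notin Crat.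
Proof.
apply/negP; rewrite -(quad_sqP (q := - 3)) ?mulr1 // => -[c c2].
by have := sqr_ge0 c; rewrite -c2.
Qed.

(** Replacing [c] by its negative exchanges the two alternatives, so the choice of the square root
    of b is immaterial. *)
Lemma quad_pPP : is_sq b ->
    (exists c : rat, c ^+ 2 = b /\ (is_sq (3 * (a + 2 * c)) \/ is_sq (3 * (a - 2 * c)))) <->
  quad (pP false) \in Crat \/ quad (pP true) \in Crat.
Proof.
rewrite (is_sqP sqrtB_sqr) => /CratP[c0 Bc0].
have c0b : c0 ^+ 2 = b.
  apply: (fmorph_inj (ratr : {rmorphism rat -> algC})).
  by rewrite rmorphXn /= -Bc0 sqrtB_sqr.
have PE (s : bool) : is_sq (3 * (a - 2 * (-1) ^+ s * c0)) <-> quad (pP s) \in Crat.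
  apply: is_sqP; rewrite /= sqrtP_sqr Bc0 rmorphM rmorphB 2!rmorphM.
  by rewrite !rmorph_nat rmorph_sign.
rewrite -!PE expr0 expr1 mulr1 mulrN1 mulNr opprK.
split=> [[c [cb H]]|H]; last by exists c0; split=> //; case: H; [right | left].
have : c ^+ 2 == c0 ^+ 2 by rewrite cb c0b.
rewrite eqf_sqr => /orP[]/eqP cc0; rewrite {}cc0 in H; first by case: H; [right | left].
by case: H; rewrite mulrN ?opprK; [left | right].
Qed.

Lemma quad_neq0 p : quad p != 0.
Proof.
case: p => [[[pe pc] pi] pj] /=; case: ifP => _; first exact: sqrtP_neq0.
have s3 := sqrtN3_neq0; have sD := sqrtD_neq0; have sB := sqrtB_neq0.
by rewrite !mulf_neq0 //; case: ifP => // _; apply: oner_neq0.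
Qed.

Definition cubic_fact (K : option (bool * nat)) : Prop :=
  if K is Some (s, k) then cubic_root s k \in Crat
  else forall s k, (k < 3)%N -> cubic_root s k \notin Crat.

(* [find] rather than [has], so that [vm_compute] stops at the first success. *)
Definition case_ok pos neg Ks gens : bool :=
  [&& check2 pos neg,
      all (fun K => (K \in kinds) &&
        (find (check_conj pos K gens) relabels < size relabels)%N) Ks
    & all (mem (quad_keys (pB \in pos))) (pos ++ neg)].

Lemma gal_is_case pos neg Ks gens : irreducible_poly (f_ab a b) ->
    case_ok pos neg Ks gens ->
    all (fun p => quad p \in Crat) pos -> all (fun p => quad p \notin Crat) neg ->
    (exists2 K, K \in Ks & cubic_fact K) ->
  gal_is (f_ab a b) (pgroup_of gens).
Proof.
move=> irr /and3P[chk2 /allP chkK /allP keys] /allP Cpos /allP Cneg [K KKs CK].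
have /andP[kK chkc] := chkK K KKs; rewrite -has_find in chkc.
have act p : p \in pos ++ neg -> sign_act p (quad p).
  move=> /keys /quad_act; apply => /Cpos; rewrite /quad /= !mul1r; exact.
apply: gal_is_of_Gal; apply: (Gal_conj _ _ _ _ chk2 kK chkc).
- exact: Gal_codes.
- exact: Gal1.
- exact: GalM.
- by move=> k; apply: Gal_trans.
- move=> w Gw; apply/allP => p pp.
  apply: sign_act_fixed (Cpos p pp) w Gw; last exact: quad_neq0.
  by apply: act; rewrite mem_cat pp.
- move=> p pn; apply: sign_act_moved (Cneg p pn).
  by apply: act; rewrite mem_cat pn orbT.
- case: K CK kK {KKs chkc} => [[s k]|] //= Ck kK; apply: (cubic_root_fixed _ Ck).
  have : all (fun K => if K is Some (_, k) then (k < 3)%N else true) kinds by [].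
  by move/allP/(_ _ kK).
by move=> K0 s k k3; rewrite K0 in CK; apply: cubic_root_moved => //; apply: CK.
Qed.

End Roots.

(** * Consequences of irreducibility and the case analysis *)

Lemma size_f_ab a b : size (f_ab a b) = 13%N.
Proof.
rewrite /f_ab -addrA size_polyDl ?size_polyXn // (leq_ltn_trans (size_polyD _ _)) //.
rewrite gtn_max ltnS (leq_trans (size_polyMleq _ _)) ?size_polyXn ?size_polyC.
  by case: (_ != 0).
by case: (_ != 0).
Qed.

Lemma irreducible_f_ab_neq0 a b : irreducible_poly (f_ab a b) -> b != 0.
Proof.
move=> [_ irr]; apply/eqP => b0.
have : 'X %| f_ab a b.
  by rewrite -['X]subr0 -root_factor_theorem rootE /f_ab b0 hornerD hornerC hornerD hornerXn
    hornerM hornerC hornerXn !expr0n /= mulr0 !addr0.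
move/irr; rewrite size_polyX => /(_ isT)/eqp_size.
by rewrite size_polyX size_f_ab.
Qed.

(** If a^2 = 4b, then f is the square of X^6 + a/2. *)
Lemma irreducible_f_ab_disc a b : irreducible_poly (f_ab a b) -> a ^+ 2 - 4 * b != 0.
Proof.
move=> [_ irr]; rewrite subr_eq0; apply/eqP => ab.
have : 'X^6 + (a / 2)%:P %| f_ab a b.
  apply/dvdpP; exists ('X^6 + (a / 2)%:P).
  have -> : b = (a / 2) ^+ 2 by rewrite expr_div_n ab; field.
  rewrite /f_ab; have {1}-> : a = a / 2 + a / 2 by field.
  rewrite polyCD [((a / 2) ^+ 2)%:P]rmorphXn /= (exprM _ 6 2).
  by move: ('X^6) ((a / 2)%:P) => X c; ring.
have sz : size ('X^6 + (a / 2)%:P) = 7%N.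
  by rewrite size_polyDl ?size_polyXn // size_polyC; case: (_ != 0).
by move/irr; rewrite sz => /(_ isT)/eqp_size; rewrite sz size_f_ab.
Qed.

(* With d = a^2 - 4b and b d = c^2, a^2 d = d^2 + 4 c^2 forces d > 0. *)
Lemma sq_disc_incompatible (a b : rat) : a ^+ 2 - 4 * b != 0 ->
  is_sq (b * (a ^+ 2 - 4 * b)) -> ~ is_sq (3 * (4 * b - a ^+ 2)).
Proof.
move=> d0 [c bd] [q dq].
have : 3 * (a ^+ 2 - 4 * b) ^+ 2 + (12 * c ^+ 2 + (a * q) ^+ 2) = 0.
  by rewrite -bd exprMn -dq; ring.
have d2 : 0 < (a ^+ 2 - 4 * b) ^+ 2 by rewrite exprn_even_gt0.
move: (_ ^+ 2) (c ^+ 2) ((a * q) ^+ 2) d2 (sqr_ge0 c) (sqr_ge0 (a * q)) => D C A; lra.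
Qed.

Lemma exists_sixth_roots (a b : rat) : b != 0 -> a ^+ 2 - 4 * b != 0 ->
  exists x y : algC, [/\ x ^+ 6 + y ^+ 6 = - ratr a, x ^+ 6 * y ^+ 6 = ratr b,
    x ^+ 6 != y ^+ 6, x != 0 & y != 0].
Proof.
move=> b0 d0; pose d : algC := sqrtC (ratr a ^+ 2 - 4 * ratr b).
have d2 : d ^+ 2 = ratr a ^+ 2 - 4 * ratr b by rewrite sqrtCK.
exists (6.-root ((- ratr a + d) / 2)), (6.-root ((- ratr a - d) / 2)).
have xy : (- ratr a + d) / 2 * ((- ratr a - d) / 2) = ratr b :> algC.
  transitivity ((ratr a ^+ 2 - d ^+ 2) / 4); first by field.
  by rewrite d2; field.
have : 6.-root ((- ratr a + d) / 2) ^+ 6 * 6.-root ((- ratr a - d) / 2) ^+ 6 != 0.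
  by rewrite !rootCK // xy fmorph_eq0.
rewrite mulf_eq0 !expf_eq0 /= negb_or => /andP[x0 y0].
rewrite !rootCK //; split=> //; first by field.
rewrite -subr_eq0 (_ : _ - _ = d); last by field.
rewrite -sqrf_eq0 d2 -(rmorph_nat (ratr : {rmorphism rat -> algC}) 4).
by rewrite -rmorphXn -rmorphM -rmorphB fmorph_eq0.
Qed.

Notation some_cube := [seq Some (false, k) | k <- iota 0 3].
Notation some_resolvent := [seq Some (true, k) | k <- iota 0 3].

Theorem theorem3p8 (a b : rat) :
  irreducible_poly (f_ab a b) ->
  let f := f_ab a b in
  let C := is_cube b in
  let R := ~ irreducible_poly (r_ab a b) in
  let S1 := is_sq (b * (a ^+ 2 - 4 * b)) in
  let Q := is_sq (3 * (4 * b - a ^+ 2)) in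
  let P := exists c : rat, c ^+ 2 = b /\
             (is_sq (3 * (a + 2 * c)) \/ is_sq (3 * (a - 2 * c))) in
  let M := is_sq (- 3 * b) in
  let N := is_sq (3 * b * (4 * b - a ^+ 2)) in
  (* case 1 *)
  (S1 -> (C \/ R) -> gal_is f T12_11) /\
  (S1 -> ~ (C \/ R) -> gal_is f T12_39) /\
  (* case 2 *)
  (~ S1 -> is_sq b -> Q -> R -> gal_is f T12_3) /\
  (~ S1 -> is_sq b -> Q -> ~ R -> C -> gal_is f T12_2) /\
  (~ S1 -> is_sq b -> Q -> ~ R -> ~ C -> gal_is f T12_18) /\
  (~ S1 -> is_sq b -> ~ Q -> P -> (C \/ R) -> gal_is f T12_3) /\
  (~ S1 -> is_sq b -> ~ Q -> P -> ~ (C \/ R) -> gal_is f T12_16) /\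
  (~ S1 -> is_sq b -> ~ Q -> ~ P -> (C \/ R) -> gal_is f T12_10) /\
  (~ S1 -> is_sq b -> ~ Q -> ~ P -> ~ (C \/ R) -> gal_is f T12_37) /\
  (* case 3 *)
  (~ S1 -> ~ is_sq b -> Q -> R -> gal_is f T12_15) /\
  (~ S1 -> ~ is_sq b -> Q -> ~ R -> C -> gal_is f T12_14) /\
  (~ S1 -> ~ is_sq b -> Q -> ~ R -> ~ C -> gal_is f T12_42) /\
  (~ S1 -> ~ is_sq b -> ~ Q -> (M \/ N) -> C -> M -> gal_is f T12_12) /\
  (~ S1 -> ~ is_sq b -> ~ Q -> (M \/ N) -> C -> ~ M -> gal_is f T12_13) /\
  (~ S1 -> ~ is_sq b -> ~ Q -> (M \/ N) -> ~ C -> R -> N -> gal_is f T12_12) /\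
  (~ S1 -> ~ is_sq b -> ~ Q -> (M \/ N) -> ~ C -> R -> ~ N -> gal_is f T12_13) /\
  (~ S1 -> ~ is_sq b -> ~ Q -> (M \/ N) -> ~ C -> ~ R -> gal_is f T12_38) /\
  (~ S1 -> ~ is_sq b -> ~ Q -> ~ M -> ~ N -> (C \/ R) -> gal_is f T12_28) /\
  (~ S1 -> ~ is_sq b -> ~ Q -> ~ M -> ~ N -> ~ (C \/ R) -> gal_is f T12_81).
Proof.
move=> irr f C R S1 Q P M N.
have b0 := irreducible_f_ab_neq0 irr; have d0 := irreducible_f_ab_disc irr.
have [x [y [sum_xy prod_xy neq_xy x0 y0]]] := exists_sixth_roots b0 d0.
have [z prim_z] := C_prim_root_exists (isT : 0 < 6)%N.
pose q := quad x y z.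
have qP := quad_sqP sum_xy prod_xy prim_z.
have S1E : S1 <-> q pS1 \in Crat by apply: qP; ring.
have BE : is_sq b <-> q pB \in Crat by apply: qP; ring.
have QE : Q <-> q pQ \in Crat by apply: qP; ring.
have ME : M <-> q pM \in Crat by apply: qP; ring.
have NE : N <-> q pN \in Crat by apply: qP; ring.
have qZ : q pZ \notin Crat := quad_pZ_nCrat sum_xy prod_xy prim_z.
have PE : is_sq b -> P <-> q (pP false) \in Crat \/ q (pP true) \in Crat.
  exact: quad_pPP.
(* In case 1 this supplies the irrationality of the square root of -3(a^2 - 4b). *)
have S1_nQ : S1 -> ~ Q := sq_disc_incompatible d0.
have notin p A : (A <-> q p \in Crat) -> ~ A -> q p \notin Crat.
  by move=> AE nA; apply/negP => /AE.
have nP s : is_sq b -> ~ P -> q (pP s) \notin Crat.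
  by move=> sb nP; apply/negP => qs; apply: nP; rewrite (PE sb); case: s qs; [right | left].
have CE : C <-> exists2 k, (k < 3)%N & cubic_root x y z false k \in Crat.
  exact: is_cubeP.
have RE : R <-> exists2 k, (k < 3)%N & cubic_root x y z true k \in Crat.
  exact: reducible_rP.
have factC : C -> exists2 K, K \in some_cube & cubic_fact x y z K.
  by case/CE => k k3 Ck; exists (Some (false, k)); rewrite // map_f // mem_iota.
have factR : R -> exists2 K, K \in some_resolvent & cubic_fact x y z K.
  by case/RE => k k3 Ck; exists (Some (true, k)); rewrite // map_f // mem_iota.
have factCR : C \/ R -> exists2 K, K \in some_cube ++ some_resolvent & cubic_fact x y z K.
  by case=> [/factC|/factR] [K Ks FK]; exists K; rewrite // mem_cat Ks ?orbT.
have factN : ~ C -> ~ R -> exists2 K, K \in [:: None] & cubic_fact x y z K.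
  move=> nC nR; exists None => // s k k3; apply/negP => Ck.
  by case: s Ck => Ck; [apply: nR; apply/RE | apply: nC; apply/CE]; exists k.
have nor : ~ (C \/ R) -> ~ C /\ ~ R by tauto.
have settle pos neg Ks gens : case_ok pos neg Ks gens ->
    (exists2 K, K \in Ks & cubic_fact x y z K) ->
    all (fun p => q p \in Crat) pos && all (fun p => q p \notin Crat) neg ->
  gal_is f (pgroup_of gens).
  by move=> ok FK /andP[Cpos Cneg]; apply: gal_is_case ok Cpos Cneg FK.
have nS1 := notin _ _ S1E; have nB := notin _ _ BE; have nQ := notin _ _ QE.
have nM := notin _ _ ME; have nN := notin _ _ NE.
clearbody q.
split.
  move=> /[dup]/S1_nQ/nQ nq /S1E s1 cr.
  apply: (settle [:: pS1] [:: pQ; pZ]) (factCR cr) _; first by vm_compute.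
  by rewrite /= s1 nq qZ.
split.
  move=> /[dup]/S1_nQ/nQ nq /S1E s1 /nor[nc nr].
  apply: (settle [:: pS1] [:: pQ; pZ]) (factN nc nr) _; first by vm_compute.
  by rewrite /= s1 nq qZ.
split.
  move=> /nS1 s1 /BE sb /QE sq r.
  apply: (settle [:: pB; pQ] [:: pS1; pZ]) (factR r) _; first by vm_compute.
  by rewrite /= s1 sb sq qZ.
split.
  move=> /nS1 s1 /BE sb /QE sq _ c.
  apply: (settle [:: pB; pQ] [:: pS1; pZ]) (factC c) _; first by vm_compute.
  by rewrite /= s1 sb sq qZ.
split.
  move=> /nS1 s1 /BE sb /QE sq nr nc.
  apply: (settle [:: pB; pQ] [:: pS1; pZ]) (factN nc nr) _; first by vm_compute.
  by rewrite /= s1 sb sq qZ.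
split.
  (* Which of the two elements s(x^3 +- y^3) is rational changes the kernel, but not the conjugacy
     class of G. *)
  move=> /nS1 s1 /[dup] sb /BE sb' /nQ nq /(PE sb)[] sp cr.
    apply: (settle [:: pB; pP false] [:: pS1; pQ; pZ]) (factCR cr) _; first by vm_compute.
    by rewrite /= s1 sb' nq sp qZ.
  apply: (settle [:: pB; pP true] [:: pS1; pQ; pZ]) (factCR cr) _; first by vm_compute.
  by rewrite /= s1 sb' nq sp qZ.
split.
  move=> /nS1 s1 /[dup] sb /BE sb' /nQ nq /(PE sb)[] sp /nor[nc nr].
    apply: (settle [:: pB; pP false] [:: pS1; pQ; pZ]) (factN nc nr) _; first by vm_compute.
    by rewrite /= s1 sb' nq sp qZ.
  apply: (settle [:: pB; pP true] [:: pS1; pQ; pZ]) (factN nc nr) _; first by vm_compute.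
  by rewrite /= s1 sb' nq sp qZ.
split.
  move=> /nS1 s1 /[dup] sb /BE sb' /nQ nq np cr.
  apply: (settle [:: pB] [:: pS1; pQ; pP false; pP true; pZ]) (factCR cr) _; first by vm_compute.
  by rewrite /= s1 sb' nq !nP ?qZ //.
split.
  move=> /nS1 s1 /[dup] sb /BE sb' /nQ nq np /nor[nc nr].
  apply: (settle [:: pB] [:: pS1; pQ; pP false; pP true; pZ]) (factN nc nr) _; first by vm_compute.
  by rewrite /= s1 sb' nq !nP ?qZ //.
split.
  move=> /nS1 s1 /nB nb /QE sq r.
  apply: (settle [:: pQ] [:: pS1; pB; pZ]) (factR r) _; first by vm_compute.
  by rewrite /= s1 nb sq qZ.
split.
  move=> /nS1 s1 /nB nb /QE sq _ c.
  apply: (settle [:: pQ] [:: pS1; pB; pZ]) (factC c) _; first by vm_compute.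
  by rewrite /= s1 nb sq qZ.
split.
  move=> /nS1 s1 /nB nb /QE sq nr nc.
  apply: (settle [:: pQ] [:: pS1; pB; pZ]) (factN nc nr) _; first by vm_compute.
  by rewrite /= s1 nb sq qZ.
split.
  move=> /nS1 s1 /nB nb /nQ nq _ c /ME sm.
  apply: (settle [:: pM] [:: pS1; pB; pQ; pZ]) (factC c) _; first by vm_compute.
  by rewrite /= s1 nb nq sm qZ.
split.
  move=> /nS1 s1 /nB nb /nQ nq + c nm => -[/nm//|/NE sn].
  apply: (settle [:: pN] [:: pS1; pB; pQ; pZ]) (factC c) _; first by vm_compute.
  by rewrite /= s1 nb nq sn qZ.
split.
  move=> /nS1 s1 /nB nb /nQ nq _ _ r /NE sn.
  apply: (settle [:: pN] [:: pS1; pB; pQ; pZ]) (factR r) _; first by vm_compute.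
  by rewrite /= s1 nb nq sn qZ.
split.
  move=> /nS1 s1 /nB nb /nQ nq + _ r nn => -[/ME sm|/nn//].
  apply: (settle [:: pM] [:: pS1; pB; pQ; pZ]) (factR r) _; first by vm_compute.
  by rewrite /= s1 nb nq sm qZ.
split.
  move=> /nS1 s1 /nB nb /nQ nq [/ME|/NE] s nc nr.
    apply: (settle [:: pM] [:: pS1; pB; pQ; pZ]) (factN nc nr) _; first by vm_compute.
    by rewrite /= s1 nb nq s qZ.
  apply: (settle [:: pN] [:: pS1; pB; pQ; pZ]) (factN nc nr) _; first by vm_compute.
  by rewrite /= s1 nb nq s qZ.
split.
  move=> /nS1 s1 /nB nb /nQ nq /nM nm /nN nn cr.
  apply: (settle [::] [:: pS1; pB; pQ; pM; pN; pZ]) (factCR cr) _; first by vm_compute.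
  by rewrite /= s1 nb nq nm nn qZ.
move=> /nS1 s1 /nB nb /nQ nq /nM nm /nN nn /nor[nc nr].
apply: (settle [::] [:: pS1; pB; pQ; pM; pN; pZ]) (factN nc nr) _; first by vm_compute.
by rewrite /= s1 nb nq nm nn qZ.
Qed.
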